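(* The following statements hold. (1) Every finite set $P$ of prime numbers with $|P|\le 4$ is of finite type. (2) For every integer $r\ge 5$, there exist only finitely many primitive sets $P$ with $|P|=r$. (3) For a positive integer $M$ put $P(M)=\{p \text{ prime} : p^2\mid M\}$, and for a positive integer $N$ put $$\mathcal{A}(N)=\{M\in\mathbb{N} : M\le N,\ P(M)\text{ is of finite type}\}.$$ Then $$0.99999991254\ \le\ \lim_{N\to\infty}\frac{|\mathcal{A}(N)|}{N}\ \le\ 0.9999999153 .$$
   Context: $\mathbb{N}$ denotes the set of positive integers. For a finite set $P$ of primes, $N(P)=\prod_{p\in P}p$. For $(x,y)\in\mathbb{N}^2$, the additive prime tree $\mathrm{APT}_P(x,y)$ is the smallest subset of $\mathbb{N}^2$ such that: (i) $(x,y)\in \mathrm{APT}_P(x,y)$; (ii) if $(X,Y)\in\mathrm{APT}_P(x,y)$, $\gcd(X,Y,N(P))=1$, and there exist $p,p'\in P$ with $p\mid X$ and $p'\mid Y$, then $(X,X+Y)\in\mathrm{APT}_P(x,y)$ and $(X+Y,Y)\in\mathrm{APT}_P(x,y)$. $P$ is of finite type if $\mathrm{APT}_P(x,y)$ is finite for every $(x,y)\in\mathbb{N}^2$; otherwise $P$ is of infinite type. A finite set $P$ of primes is a primitive set if it is of infinite type and every proper subset of $P$ is of finite type. *)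

(* Defs.v *)
From mathcomp Require Import all_boot all_order all_algebra finmap.
From mathcomp Require Import all_classical all_reals all_analysis.
Import Order.TTheory GRing.Theory Num.Theory.
Import numFieldNormedType.Exports.

Set Implicit Arguments.
Unset Strict Implicit.
Unset Printing Implicit Defensive.

Local Open Scope classical_set_scope.
Local Open Scope ring_scope.

Definition primes_prod (P : {fset nat}) : nat := (\prod_(p <- P) p)%N.

Inductive APT (P : {fset nat}) (x y : nat) : nat * nat -> Prop :=
| APT_root : APT P x y (x, y)
| APT_left X Y : APT P x y (X, Y) ->
    gcdn (gcdn X Y) (primes_prod P) = 1%N ->
    (exists p p' : nat, [/\ p \in P, p' \in P, (p %| X)%N & (p' %| Y)%N]) ->
    APT P x y (X, X + Y)%N
| APT_right X Y : APT P x y (X, Y) ->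
    gcdn (gcdn X Y) (primes_prod P) = 1%N ->
    (exists p p' : nat, [/\ p \in P, p' \in P, (p %| X)%N & (p' %| Y)%N]) ->
    APT P x y (X + Y, Y)%N.

Definition prime_fset (P : {fset nat}) : Prop :=
  forall p : nat, p \in P -> prime p.

(* The roots (x, y) have positive entries, and then so do all nodes. *)
Definition finite_type (P : {fset nat}) : Prop :=
  forall x y : nat, (0 < x)%N -> (0 < y)%N -> finite_set [set z | APT P x y z].

Definition infinite_type (P : {fset nat}) : Prop := ~ finite_type P.

Definition primitive_set (P : {fset nat}) : Prop :=
  [/\ prime_fset P, infinite_type P &
      forall Q : {fset nat}, (Q `<` P)%fset -> finite_type Q].

(* For M > 0, [primes M] lists all the prime divisors of M. *)
Definition square_primes (M : nat) : {fset nat} :=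
  [fset p in primes M | (p ^ 2 %| M)%N]%fset.

Definition finite_type_upto (N : nat) : {fset nat} :=
  [fset M in iota 1 N | `[< finite_type (square_primes M) >]]%fset.

Definition finite_type_ratio (R : realType) : R^nat := fun N =>
  #|` finite_type_upto N|%:R / N%:R.

(* Main.v *)
(* An infinite branch of the tree of P is a walk of pairs (X, Y) in which every
   X and every Y has a divisor in P; modulo the primes of P it can be closed up
   to a periodic two-sided walk.  Each p in P divides only the linear forms
   lying on one line modulo p, so if p divides two forms it divides their
   determinant.  Starting from the middle of a longest run of equal steps and
   extending the walk in both directions, a form that is not yet divisible by
   an assigned prime gets a new, undetermined prime, or determines a previous
   one as a divisor of a determinant; for at most six primes this search is
   finite and ends with a superset of one of 29 sets, all of size 5 or 6.

   For the finiteness of primitive sets of size r: a prime larger than 2 ^ W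
   divides at most one of the forms X + Y met in W steps, so primes that are
   large compared with a finite type set S cannot help S.

   For the density: truncating to primes at most B makes the condition on M
   periodic, at a cost of density at most 1 / B.  Integers of infinite type
   contain one of the two 5-sets, or one of the 27 6-sets, or have seven square
   prime divisors without containing any of these; the last density is bounded
   by elementary symmetric sums of the 1 / p ^ 2. *)
Require Import Defs.
From HB Require Import structures.
From Stdlib Require Import ZArith Znumtheory FMapPositive.
From mathcomp Require Import all_boot all_order all_algebra finmap.
From mathcomp Require Import all_classical all_reals all_analysis.
From mathcomp Require Import ssrZ zify.
Import Order.TTheory GRing.Theory Num.Theory.
Import numFieldNormedType.Exports.

Set Implicit Arguments.
Unset Strict Implicit.
Unset Printing Implicit Defensive.

(** * The search for infinite walks *)

(** The search proves one implication: an infinite type set of at most six primes contains a listed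
    set. Infinite type itself is shown only for the two 5-sets, by explicit closed walks. So these
    two alone give the upper bound for the limit, while the 6-sets and the integers with seven
    square prime divisors are an allowance made in the lower bound; this is why the two bounds
    differ. Starting at a longest run does two things: it fixes the first steps of the walk, and it
    excludes every longer run afterwards. Exchanging X and Y lets the run be taken in one direction
    only. The limit is obtained without describing the infinite type sets. The periodic
    approximations have densities that depend on the truncation, and the Cauchy criterion needs no
    more than that. *)

Section PathSearch.
Local Open Scope Z_scope.

Fixpoint trial_division (fuel : nat) (p n : Z) : seq Z :=
  if fuel is fuel'.+1 then
    if n <? p * p then [:: n]
    else let: (q, r) := Z.div_eucl n p in
         if r =? 0 then p :: trial_division fuel' p q
         else trial_division fuel' (p + 1) n
  else [::].

(* Only primes above 5: the search decides 2, 3 and 5 at the outset. *)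
Definition prime_factors (n : Z) : seq Z :=
  [seq p <- undup (trial_division (Z.to_nat n) 2 n) | 5 <? p].

Definition factor_table : PositiveMap.t (seq Z) :=
  Eval vm_compute in
  foldr (fun n => PositiveMap.add (Pos.of_nat n) (prime_factors (Z.of_nat n)))
    (PositiveMap.empty _) (iota 1 4096).

Definition factors (d : Z) : seq Z :=
  match d with
  | Z0 => [::]
  | Zpos n | Zneg n =>
    if PositiveMap.find n factor_table is Some l then l
    else prime_factors (Zpos n)
  end.

(* For a linear form z, [Entry x y x' y'] holds the values of det (z, -) at the
   two forms of the last pair of the window (x, y) and at those of its first
   pair (x', y'): integers as long as the prime dividing z is undetermined
   (modulus 0), residues once it is known. *)
Inductive entry := Entry of Z & Z & Z & Z.

Definition addm (m x y : Z) : Z :=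
  let s := x + y in
  if m =? 0 then s else if s <? m then s else s - m.

Definition subm (m x y : Z) : Z :=
  let s := x - y in
  if m =? 0 then s else if s <? 0 then s + m else s.

(* Determined primes, undetermined primes, number of primes not yet in use. *)
Inductive state := State of seq (Z * entry) & seq entry & nat.

(* The largest prime comes first, so that a failing inclusion test fails early. *)
Definition known_sets : seq (seq Z) :=
  [:: [:: 19; 7; 5; 3; 2]; [:: 17; 13; 5; 3; 2];
      [:: 13; 11; 7; 5; 3; 2]; [:: 23; 11; 7; 5; 3; 2];
      [:: 223; 11; 7; 5; 3; 2]; [:: 1499; 11; 7; 5; 3; 2];
      [:: 29; 13; 7; 5; 3; 2]; [:: 41; 29; 7; 5; 3; 2];
      [:: 59; 37; 7; 5; 3; 2]; [:: 103; 41; 7; 5; 3; 2];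
      [:: 113; 97; 7; 5; 3; 2]; [:: 229; 149; 7; 5; 3; 2];
      [:: 23; 13; 11; 5; 3; 2]; [:: 97; 13; 11; 5; 3; 2];
      [:: 31; 19; 11; 5; 3; 2]; [:: 53; 29; 11; 5; 3; 2];
      [:: 107; 31; 11; 5; 3; 2]; [:: 61; 59; 11; 5; 3; 2];
      [:: 89; 19; 17; 5; 3; 2]; [:: 79; 67; 17; 5; 3; 2];
      [:: 61; 31; 23; 5; 3; 2]; [:: 103; 41; 29; 5; 3; 2];
      [:: 103; 71; 67; 5; 3; 2]; [:: 337; 257; 101; 5; 3; 2];
      [:: 23; 13; 11; 7; 3; 2]; [:: 41; 31; 17; 7; 3; 2];
      [:: 53; 43; 41; 29; 3; 2]; [:: 43; 13; 11; 7; 5; 2];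
      [:: 59; 37; 31; 7; 5; 2]].

Definition memZ (p : Z) (s : seq Z) : bool := has (Z.eqb p) s.

Definition contains_known (s : seq Z) : bool :=
  has (all (fun p => memZ p s)) known_sets.

Definition reduce (p : Z) (e : entry) : entry :=
  let: Entry a b c d := e in Entry (a mod p) (b mod p) (c mod p) (d mod p).

(** An undetermined prime that divides both [z] and the form under test divides [val 0 e], the
    determinant of the two. Supersets of a listed set are discarded here, which is how they leave
    the search. *)
Fixpoint promotions (val : Z -> entry -> Z) (D : seq (Z * entry))
    (G0 G : seq entry) (k : nat) : seq state :=
  if G is e :: G' then
    [seq State ((p, reduce p e) :: D) (G0 ++ G') k
       | p <- factors (val 0 e)
       & ~~ memZ p (map fst D) && ~~ contains_known (p :: map fst D)]
    ++ promotions val D (rcons G0 e) G' k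
  else [::].

(** A zero value for a determined prime, or a zero determinant with an undetermined one, means that
    the form under test is covered already and no choice has to be made. *)
Definition options (val : Z -> entry -> Z) (new : entry) (st : state) :
    seq state :=
  let: State D G k := st in
  if has (fun pe => val pe.1 pe.2 =? 0) D then [:: st]
  else if has (fun e => val 0 e =? 0) G then [:: st]
  else let l := promotions val D [::] G k in
       if k is k'.+1 then State D (new :: G) k' :: l else l.

Definition fst_val (m : Z) (e : entry) : Z := let: Entry x _ _ _ := e in x.
Definition snd_val (m : Z) (e : entry) : Z := let: Entry _ y _ _ := e in y.
(** Either step forward creates the form X + Y, and either step backward uncovers X - Y up to sign.
    So the new form is covered first, and the direction is chosen afterwards. *)
Definition fwd_val (m : Z) (e : entry) : Z :=
  let: Entry x y _ _ := e in addm m x y.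
Definition bwd_val (m : Z) (e : entry) : Z :=
  let: Entry _ _ x y := e in subm m x y.

Definition fwd_move (b : bool) (m : Z) (e : entry) : entry :=
  let: Entry x y x' y' := e in
  if b then Entry (addm m x y) y x' y' else Entry x (addm m x y) x' y'.
Definition bwd_move (b : bool) (m : Z) (e : entry) : entry :=
  let: Entry x y x' y' := e in
  if b then Entry x y (subm m x' y') y' else Entry x y x' (subm m y' x').

Definition map_state (f : Z -> entry -> entry) (st : state) : state :=
  let: State D G k := st in
  State [seq (pe.1, f pe.1 pe.2) | pe <- D] (map (f 0) G) k.

(* The first pair of the window in terms of the last one:
   X_i = al X_j + be Y_j and Y_i = ga X_j + de Y_j. *)
Inductive frame := Frame of Z & Z & Z & Z.

Definition fwd_frame (b : bool) (w : frame) : frame :=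
  let: Frame al be ga de := w in
  if b then Frame al (be - al) ga (de - ga) else Frame (al - be) be (ga - de) de.
Definition bwd_frame (b : bool) (w : frame) : frame :=
  let: Frame al be ga de := w in
  if b then Frame (al - ga) (be - de) ga de else Frame al be (ga - al) (de - be).

(** Modulo a prime that divides X_j + Y_j the last pair is proportional to (-1, 1), and the frame
    carries this to the first pair. In [bwd_new] the first pair is proportional to (1, 1), and the
    inverse frame, of determinant 1, gives the last pair. *)
Definition fwd_new (w : frame) : entry :=
  let: Frame al be ga de := w in Entry (-1) 1 (be - al) (de - ga).
Definition bwd_new (w : frame) : entry :=
  let: Frame al be ga de := w in Entry (de - be) (al - ga) 1 1.

Inductive run := Run of bool & nat.
Definition extend (b : bool) (r : run) : run :=
  let: Run c n := r in Run b (if b == c then n.+1 else 1%N).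
Definition short (a : nat) (r : run) : bool := let: Run _ n := r in (n <= a)%N.

Variable a : nat.

(* With all primes determined the walk is only followed forward. *)
Fixpoint closed_search (fuel : nat) (D : seq (Z * Z * Z)) (r : run) : bool :=
  if fuel is n.+1 then
    if has (fun t => let: (p, x, y) := t in addm p x y =? 0) D then
      (if short a (extend false r) then
         closed_search n
           [seq let: (p, x, y) := t in (p, x, addm p x y) | t <- D] (extend false r)
       else true) &&
      (if short a (extend true r) then
         closed_search n
           [seq let: (p, x, y) := t in (p, addm p x y, y) | t <- D] (extend true r)
       else true)
    else true
  else false.

Definition branching (r : run) : nat :=
  short a (extend false r) + short a (extend true r).

(** The value [true] certifies that every branch dies or was discarded as a superset of a listed
    set. Exhausted fuel gives [false], so the amount of fuel needs no justification. Either side may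
    be extended; taking the one with fewer successors keeps the tree small. *)
Fixpoint search (fuel : nat) (st : state) (w : frame) (rf rb : run) : bool :=
  if fuel is n.+1 then
    let: State D G k := st in
    if (if k is 0%N then nilp G else false) then
      if has (fun pe => bwd_val pe.1 pe.2 =? 0) D then
        closed_search 200
          [seq let: (p, Entry x y _ _) := pe in (p, x, y) | pe <- D] rf
      else true
    else
      let F := options fwd_val (fwd_new w) st in
      if nilp F then true else
      let B := options bwd_val (bwd_new w) st in
      if (size F * branching rf <= size B * branching rb)%N then
        all (fun b =>
          if short a (extend b rf) then
            all (fun st' =>
              search n (map_state (fwd_move b) st') (fwd_frame b w) (extend b rf) rb) F
          else true) [:: false; true]
      else
        all (fun b =>
          if short a (extend b rb) then
            all (fun st' =>
              search n (map_state (bwd_move b) st') (bwd_frame b w) rf (extend b rb)) B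
          else true) [:: false; true]
  else false.

(* The points of the projective line modulo p. *)
Definition points (p : Z) : seq (Z * entry) :=
  (p, Entry 1 0 1 0) ::
  [seq (p, let t := Z.of_nat n in Entry t 1 t 1) | n <- iota 0 (Z.to_nat p)].

Fixpoint start_points (S : seq Z) : seq (seq (Z * entry)) :=
  if S is p :: S' then
    [seq pe :: D | pe <- points p, D <- start_points S']
  else [:: [::]].

(** [Entry 0 1 0 1] holds the determinants of the form X with X and Y, and [Entry (-1) 0 (-1) 0]
    those of Y: both entries of the initial pair have to be covered. *)
Definition start_states (S : seq Z) (k : nat) : seq state :=
  flatten (map (options snd_val (Entry (-1) 0 (-1) 0))
    (flatten (map (options fst_val (Entry 0 1 0 1))
       [seq State D [::] k | D <- start_points S]))).

Definition fwd_word_step (l : seq (state * frame)) (b : bool) :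
    seq (state * frame) :=
  flatten [seq [seq (map_state (fwd_move b) st, fwd_frame b sw.2)
     | st <- options fwd_val (fwd_new sw.2) sw.1] | sw <- l].

Definition word_states (S : seq Z) (k : nat) (u : seq bool) :
    seq (state * frame) :=
  foldl fwd_word_step [seq (st, Frame 1 0 0 1) | st <- start_states S k] u.

(* The window initially shows a longest run, of length a, and its neighbours. *)
Definition anchored_search (S : seq Z) (k : nat) : bool :=
  all (fun sw => search 300 sw.1 sw.2 (Run true 1) (Run true 1))
    (word_states S k (true :: rcons (nseq a false) true)).

End PathSearch.

(** * The computations for all initial data *)

Section Certificates.
Local Open Scope Z_scope.

Definition small_sets : seq (seq Z) :=
  [:: [::]; [:: 5]; [:: 3]; [:: 3; 5]; [:: 2]; [:: 2; 5]; [:: 2; 3]; [:: 2; 3; 5]].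

Definition search_succeeds : bool :=
  all (fun S => all (fun a => anchored_search a S (6 - size S)%N) (iota 1 12)%N)
    small_sets.

(** Thirteen steps [false] from (X, Y) ask for divisors of the 14 terms Y, Y + X, ..., Y + 13 X. One
    prime is spent on X and divides none of them, and five primes cannot cover 14 consecutive terms:
    Jacobsthal's function is 14 at the first five primes. *)
Definition no_long_run : bool :=
  all (fun S => nilp (word_states S (6 - size S)%N (nseq 13%N false))) small_sets.
Lemma no_long_runT : no_long_run. Proof. by vm_compute. Qed.

Lemma search_succeedsT : search_succeeds.
Proof. by vm_cast_no_check (erefl true). Qed.

End Certificates.

(** * Completeness of trial division *)

Section Factors.
Local Open Scope Z_scope.

Lemma divide_lin (q a b c u v : Z) :
  (q | a) -> (q | b) -> c = u * a + v * b -> (q | c).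
Proof.
by move=> qa qb ->; apply: Z.divide_add_r; apply: Z.divide_mul_r.
Qed.

(** The invariant is that [n] has no divisor strictly between 1 and [p]; so once [n < p * p] it is
    prime and equals [q]. Division and increment both lower [n - p], hence the fuel suffices. *)
Lemma trial_division_complete (fuel : nat) (p n q : Z) :
  2 <= p -> 1 < n -> n - p < Z.of_nat fuel ->
  (forall e, 1 < e -> (e | n) -> p <= e) ->
  Znumtheory.prime q -> (q | n) -> q \in trial_division fuel p n.
Proof.
elim: fuel p n => [|fuel IH] p n p2 n1 fuel_n rough q_pr qn.
  by have := rough n n1 (Z.divide_refl n); lia.
have q1 := prime_ge_2 q q_pr.
have pq : p <= q by apply: rough => //; lia.
rewrite /=; case: Z.ltb_spec => [n_lt|n_ge].
  rewrite inE; apply/eqP; case: qn => m nE.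
  have [m_le1|m_gt1] := Z.le_gt_cases m 1; first by have m1 : m = 1; nia.
  have : p <= m by apply: rough; [lia|exists q; lia].
  by nia.
have := Z_div_mod n p ltac:(lia); case: (Z.div_eucl n p) => m r [nE r_bd].
case: Z.eqb_spec => [r0|r_neq0]; last first.
  apply: IH => //; try lia.
  move=> e e1 en; have := rough e e1 en.
  have: e <> p by move=> ep; case: en => t tE; subst e; have [?|?] := Z.le_gt_cases t m; nia.
  by lia.
rewrite inE; have {}nE : n = p * m by lia.
have mdvd e : (e | m) -> (e | n) by move=> em; rewrite nE; exact: Z.divide_mul_r.
have [qp|qm] := prime_mult q q_pr p m ltac:(by rewrite -nE).
  by have := Z.divide_pos_le q p ltac:(lia) qp => ?; apply/orP; left; apply/eqP; lia.
apply/orP; right.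
have m1 : 1 < m by have := Z.divide_pos_le q m ltac:(nia) qm; lia.
apply: IH => //; first by nia.
by move=> e e1 em; apply: rough => //; exact: mdvd.
Qed.

Lemma prime_factors_complete (n q : Z) :
  0 < n -> 5 < q -> Znumtheory.prime q -> (q | n) -> q \in prime_factors n.
Proof.
move=> n0 q5 q_pr qn; rewrite mem_filter mem_undup.
have qlen := Z.divide_pos_le q n n0 qn.
apply/andP; split; first exact/Z.ltb_spec0.
by apply: trial_division_complete => //; lia.
Qed.

Lemma factor_table_correct (n : positive) (l : seq Z) :
  PositiveMap.find n factor_table = Some l -> l = prime_factors (Zpos n).
Proof.
have chk : all (fun nl => nl.2 == prime_factors (Zpos nl.1))
               (PositiveMap.elements factor_table).
  by vm_compute.
move=> find_n; have := PositiveMap.elements_correct factor_table n find_n.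
move: (PositiveMap.elements _) chk.
elim=> //=.
by move=> nl s IH /andP[/eqP nlE /IH{}IH] [nl_eq|//]; subst nl.
Qed.

Lemma factors_complete (d q : Z) :
  d <> 0 -> 5 < q -> Znumtheory.prime q -> (q | d) -> q \in factors d.
Proof.
have main n : 5 < q -> Znumtheory.prime q -> (q | Zpos n) -> q \in factors (Zpos n).
  move=> q5 q_pr qn; rewrite /factors.
  case find_n: PositiveMap.find => [l|]; first rewrite (factor_table_correct find_n).
    exact: prime_factors_complete.
  exact: prime_factors_complete.
case: d => [//|n|n] _ q5 q_pr qn; first exact: main.
by apply: (main n) => //; rewrite -[Zpos n]/(- Zneg n); apply/Z.divide_opp_r.
Qed.
End Factors.

Definition tuple_of_entry (e : entry) := let: Entry x y x' y' := e in (x, y, x', y').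
Definition entry_of_tuple t := let: (x, y, x', y') := t in Entry x y x' y'.
Lemma tuple_of_entryK : cancel tuple_of_entry entry_of_tuple.
Proof. by case. Qed.
HB.instance Definition _ := Equality.copy entry (can_type tuple_of_entryK).

Arguments closed_search : simpl never.
Arguments options : simpl never.

Lemma closed_searchS a n D r : closed_search a n.+1 D r =
  if has (fun t : Z * Z * Z => let: (p, x, y) := t in addm p x y =? 0)%Z D then
    (if short a (extend false r) then
       closed_search a n
         [seq let: (p, x, y) := t in (p, x, addm p x y) | t <- D] (extend false r)
     else true) &&
    (if short a (extend true r) then
       closed_search a n
         [seq let: (p, x, y) := t in (p, addm p x y, y) | t <- D] (extend true r)
     else true)
  else true.
Proof. by []. Qed.

Lemma all_flatten (T : Type) (f : pred T) (ss : seq (seq T)) :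
  all f (flatten ss) = all (all f) ss.
Proof. by elim: ss => //= s ss IH; rewrite all_cat IH. Qed.

(** * Soundness of the search for a two-sided walk *)

Section Soundness.
Local Open Scope Z_scope.

Lemma memZE (p : Z) (s : seq Z) : memZ p s = (p \in s).
Proof. by rewrite /memZ -has_pred1; apply: eq_has => x /=; rewrite eq_sym. Qed.

(** Congruences are proved by certificates: the coefficients [u1] to [u5] are supplied, and a ring
    identity remains. *)
Lemma divide_lin5 (q a1 a2 a3 a4 a5 u1 u2 u3 u4 u5 c : Z) :
  (q | a1) -> (q | a2) -> (q | a3) -> (q | a4) -> (q | a5) ->
  c = u1 * a1 + u2 * a2 + u3 * a3 + u4 * a4 + u5 * a5 -> (q | c).
Proof. by do 5!case=> ? ->; move=> ->; rewrite !Z.mul_assoc -!Z.mul_add_distr_r; apply: Z.divide_factor_r. Qed.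

Lemma addm_divide (m q x y : Z) :
  m = 0 \/ m = q -> (q | addm m x y - (x + y)).
Proof.
rewrite /addm => mE; case: Z.eqb_spec => m0.
  by rewrite Z.sub_diag; exact: Z.divide_0_r.
case: ifP => _; first by rewrite Z.sub_diag; exact: Z.divide_0_r.
by case: mE => // ->; exists (-1); lia.
Qed.

Lemma subm_divide (m q x y : Z) :
  m = 0 \/ m = q -> (q | subm m x y - (x - y)).
Proof.
rewrite /subm => mE; case: Z.eqb_spec => m0.
  by rewrite Z.sub_diag; exact: Z.divide_0_r.
case: ifP => _; last by rewrite Z.sub_diag; exact: Z.divide_0_r.
by case: mE => // ->; exists 1; lia.
Qed.

Lemma addm_range (q x y : Z) :
  0 <= x < q -> 0 <= y < q -> 0 <= addm q x y < q.
Proof.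
by rewrite /addm => *; case: Z.eqb_spec; [lia|case: Z.ltb_spec; lia].
Qed.

Lemma subm_range (q x y : Z) :
  0 <= x < q -> 0 <= y < q -> 0 <= subm q x y < q.
Proof.
by rewrite /subm => *; case: Z.eqb_spec; [lia|case: Z.ltb_spec; lia].
Qed.

Lemma divide_range0 (q x : Z) : 0 <= x < q -> (q | x) -> x = 0.
Proof.
move=> [x0 xq] qx; have [//|xn0] := Z.eq_dec x 0.
by have := Z.divide_pos_le q x ltac:(lia) qx; lia.
Qed.

Lemma invertible_mod (q x : Z) :
  Znumtheory.prime q -> ~ (q | x) -> exists c, (q | 1 - c * x).
Proof.
move=> q_pr /(prime_rel_prime q q_pr x)/rel_prime_bezout[u v uv].
by exists v; exists u; lia.
Qed.

(** The recurrences are stated modulo the primes of [P], since a walk that has been closed up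
    satisfies them at its seams only in this sense. *)
Variables (P : seq Z) (X Y : Z -> Z) (d : Z -> bool) (a : nat).
Hypothesis P_uniq : uniq P.
Hypothesis P_prime : forall q, q \in P -> Znumtheory.prime q.
Hypothesis X_step : forall q k, q \in P ->
  (q | X (k + 1) - (if d k then X k + Y k else X k)).
Hypothesis Y_step : forall q k, q \in P ->
  (q | Y (k + 1) - (if d k then Y k else X k + Y k)).
Hypothesis XY_coprime : forall q k, q \in P -> (q | X k) -> (q | Y k) -> False.
Hypothesis X_cover : forall k, exists2 q, q \in P & (q | X k).
Hypothesis Y_cover : forall k, exists2 q, q \in P & (q | Y k).
Hypothesis runs_le : forall k,
  ~ (forall t : nat, (t <= a)%N -> d (k + Z.of_nat t) = d k).

Definition contained : Prop :=
  exists2 K, K \in known_sets & {subset K <= P}.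

(** If [q] divides the form [z], the numbers det (z, -) are, modulo [q], a common multiple [c] of
    the values of the forms. So det (z, w) vanishes modulo [q] whenever [q] divides [w]. *)
Definition linked (i j q : Z) (e : entry) : Prop :=
  let: Entry x y x' y' := e in
  exists c, [/\ (q | x - c * X j), (q | y - c * Y j),
                (q | x' - c * X i) & (q | y' - c * Y i)].

Definition reduced (q : Z) (e : entry) : Prop :=
  let: Entry x y x' y' := e in
  [/\ 0 <= x < q, 0 <= y < q, 0 <= x' < q & 0 <= y' < q].

Definition tracks (i j m q : Z) (e : entry) : Prop :=
  linked i j q e /\ (m = 0 \/ m = q /\ reduced q e).

(** [GQ] restores the actual primes behind the undetermined entries, which the search does not
    know. *)
Definition state_ok (i j : Z) (st : state) : Prop :=
  let: State D G k := st in
  exists GQ : seq (Z * entry),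
    [/\ G = map snd GQ,
        {in D, forall pe, tracks i j pe.1 pe.1 pe.2},
        {in GQ, forall pe, tracks i j 0 pe.1 pe.2} &
        [/\ uniq (map fst (D ++ GQ)), {subset map fst (D ++ GQ) <= P},
            (size P <= size D + size GQ + k)%N &
            forall p, p \in P -> p <= 5 -> p \in map fst D]].

(** A nonzero value thus excludes a determined [q] as a divisor of [w], and leaves only prime
    factors of the value for an undetermined one. *)
Definition evaluates (i j : Z) (val : Z -> entry -> Z) (w : Z) : Prop :=
  forall m q e, q \in P -> tracks i j m q e -> (q | w) ->
    (q | val m e) /\ (m = q -> 0 <= val m e < q).

Lemma contains_known_contained (s : seq Z) :
  contains_known s -> {subset s <= P} -> contained.
Proof.
move=> /hasP[K K_known /allP Ks] sP; exists K => // p /Ks.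
by rewrite memZE => /sP.
Qed.

Lemma reduce_tracks (i j q : Z) (e : entry) :
  q \in P -> linked i j q e -> tracks i j q q (reduce q e).
Proof.
move=> qP; have q1 := prime_ge_2 q (P_prime qP).
have mod_sub x y : (q | x - y) -> (q | x mod q - y).
  move=> qxy; rewrite Z.mod_eq; last lia.
  by apply: (divide_lin (u := 1) (v := - (x / q)) qxy (Z.divide_refl q)); lia.
have mod_range x : 0 <= x mod q < q by apply: Z.mod_pos_bound; lia.
case: e => x y x' y' [c [xc yc x'c y'c]]; split; last by right; split.
by exists c; split; apply: mod_sub.
Qed.

Lemma promotions_sound (f : state -> bool) val D (G0 G1 G2 : seq entry) e k p :
  all f (promotions val D G0 (G1 ++ e :: G2) k) -> p \in factors (val 0 e) ->
  p \notin map fst D ->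
  contains_known (p :: map fst D) \/
  f (State ((p, reduce p e) :: D) (G0 ++ G1 ++ G2) k).
Proof.
elim: G1 G0 => [|e' G1 IH] G0 /=; rewrite all_cat => /andP[all1 all2] pf pD.
  have [|notk] := boolP (contains_known _); [by left|right].
  move: all1; rewrite all_map => /allP; apply.
  by rewrite mem_filter pf memZE pD notk.
by have := IH _ all2 pf pD; rewrite cat_rcons.
Qed.

(** Unless the form is covered already, consider the prime [q] that divides [w] in the actual walk.
    If it is determined, its value is zero; if it is undetermined, it exceeds 5 and divides a
    nonzero determinant, so it is promoted; if it is not in use, counting shows that [k] is
    positive. As [f] is arbitrary, the correct state is listed unless it was discarded. *)
Lemma options_sound (f : state -> bool) i j val new w st :
  evaluates i j val w -> (forall q, q \in P -> (q | w) -> linked i j q new) ->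
  (exists2 q, q \in P & (q | w)) -> state_ok i j st ->
  all f (options val new st) ->
  contained \/ exists2 st', state_ok i j st' & f st'.
Proof.
case: st => D G k val_w new_w [q qP qw] [GQ [GE D_ok GQ_ok A_ok]].
case: A_ok => [A_uniq A_sub A_size A_small].
have st_ok : state_ok i j (State D G k) by exists GQ; split.
rewrite /options; case: ifP => [_ /= /andP[f_st _]|D_unc]; first by right; eexists; eauto.
case: ifP => [_ /= /andP[f_st _]|G_unc]; first by right; eexists; eauto.
move: D_unc G_unc => /negbT/hasPn D_unc /negbT/hasPn G_unc all_f.
have qD : q \notin map fst D.
  apply/negP => /mapP[[q' e] peD /= qE]; subst q'.
  have [qval range] := val_w _ _ _ qP (D_ok _ peD) qw.
  by have := D_unc _ peD; rewrite /= (divide_range0 (range erefl) qval).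
have [/mapP[[q' e] peG /= qE]|qG] := boolP (q \in map fst GQ).
  subst q'; have [qval _] := val_w _ _ _ qP (GQ_ok _ peG) qw.
  have val_neq0 : val 0 e <> 0.
    by apply/Z.eqb_neq/negbTE/G_unc; rewrite GE; apply/mapP; exists (q, e).
  have q5 : 5 < q.
    by case: (Z.lt_ge_cases 5 q) => // /(A_small q qP) q_in; case/negP: qD.
  case/splitPr: peG GE GQ_ok A_uniq A_sub A_size => G1 G2 GE GQ_ok A_uniq A_sub A_size.
  have {}all_f : all f (promotions val D [::] (map snd G1 ++ e :: map snd G2) k).
    by move: all_f; rewrite GE map_cat /=; case: k A_size st_ok => // k _ _ /andP[].
  have qfac := factors_complete val_neq0 q5 (P_prime qP) qval.
  have [known|f_st] := promotions_sound all_f qfac qD.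
    left; apply: contains_known_contained known _ => p; rewrite inE => /predU1P[->//|pD].
    by apply: A_sub; rewrite map_cat mem_cat pD.
  right; exists (State ((q, reduce q e) :: D) (map snd (G1 ++ G2)) k); last first.
    by rewrite map_cat.
  exists (G1 ++ G2); split => //.
  - move=> pe; rewrite inE => /predU1P[->/=|/D_ok//].
    by apply: reduce_tracks => //; have [|//] := GQ_ok (q, e); rewrite mem_cat inE eqxx orbT.
  - by move=> pe peG; apply: GQ_ok; move: peG; rewrite !mem_cat inE => /orP[]->; rewrite ?orbT.
  have A_perm : perm_eq (map fst (D ++ G1 ++ (q, e) :: G2)) (map fst ((q, reduce q e) :: D ++ G1 ++ G2)).
    by rewrite /= !map_cat /=; apply/permP => z; rewrite /= !count_cat /= [RHS]addnCA; congr addn; exact: addnCA.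
  split.
  - by rewrite -(perm_uniq A_perm).
  - by move=> p; rewrite -(perm_mem A_perm); exact: A_sub.
  - by move: A_size; rewrite !size_cat /=; lia.
  - by move=> p pP p5; rewrite inE A_small ?orbT.
have qA : uniq (q :: map fst (D ++ GQ)).
  by rewrite cons_uniq A_uniq map_cat mem_cat negb_or qD qG.
have sub_qA : {subset q :: map fst (D ++ GQ) <= P}.
  by move=> p; rewrite inE => /predU1P[->//|/A_sub].
have := uniq_leq_size qA sub_qA; rewrite /= size_map size_cat => A_lt.
case: k A_size st_ok all_f => [|k] A_size st_ok; first by lia.
case/andP=> f_st _; right; exists (State D (new :: G) k) => //.
have A_perm : perm_eq (q :: map fst (D ++ GQ)) (map fst (D ++ (q, new) :: GQ)).
  by rewrite !map_cat /=; apply/permP => z; rewrite /= !count_cat /= addnCA.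
exists ((q, new) :: GQ); split => //=; first by rewrite GE.
  move=> pe; rewrite inE => /predU1P[->/=|/GQ_ok//].
  by split; [exact: new_w|left].
split => //; first by rewrite -(perm_uniq A_perm).
  by move=> p; rewrite -(perm_mem A_perm); exact: sub_qA.
by lia.
Qed.

Lemma linked_fwd b i j q e m : q \in P -> d j = b -> m = 0 \/ m = q ->
  linked i j q e -> linked i (j + 1) q (fwd_move b m e).
Proof.
move=> qP db mE; have := X_step j qP; have := Y_step j qP; rewrite db.
case: e => x y x' y' Yj Xj [c [xc yc x'c y'c]].
have xy := addm_divide x y mE; case: b {db} Yj Xj => Yj Xj; exists c; split => //.
- by apply: (divide_lin5 (u1 := - c) (u2 := 1) (u3 := 1) (u4 := 1) (u5 := 0) Xj xc yc xy xc); ring.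
- by apply: (divide_lin (u := - c) (v := 1) Yj yc); ring.
- by apply: (divide_lin (u := - c) (v := 1) Xj xc); ring.
- by apply: (divide_lin5 (u1 := - c) (u2 := 1) (u3 := 1) (u4 := 1) (u5 := 0) Yj xc yc xy xc); ring.
Qed.

Lemma linked_bwd b i j q e m : q \in P -> d (i - 1) = b -> m = 0 \/ m = q ->
  linked i j q e -> linked (i - 1) j q (bwd_move b m e).
Proof.
move=> qP db mE; have := X_step (i - 1) qP; have := Y_step (i - 1) qP.
rewrite db Z.sub_add; case: e => x y x' y' Yi Xi [c [xc yc x'c y'c]].
have xy := subm_divide x' y' mE; have yx := subm_divide y' x' mE.
case: b {db} Yi Xi => Yi Xi; exists c; split => //.
- by apply: (divide_lin5 (u1 := c) (u2 := - c) (u3 := 1) (u4 := - 1) (u5 := 1) Xi Yi x'c y'c xy); ring.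
- by apply: (divide_lin (u := c) (v := 1) Yi y'c); ring.
- by apply: (divide_lin (u := c) (v := 1) Xi x'c); ring.
- by apply: (divide_lin5 (u1 := - c) (u2 := c) (u3 := - 1) (u4 := 1) (u5 := 1) Xi Yi x'c y'c yx); ring.
Qed.

Lemma reduced_fwd b q e : reduced q e -> reduced q (fwd_move b q e).
Proof.
by case: e => x y x' y' [? ? ? ?]; case: b; split => //; apply: addm_range.
Qed.

Lemma reduced_bwd b q e : reduced q e -> reduced q (bwd_move b q e).
Proof.
by case: e => x y x' y' [? ? ? ?]; case: b; split => //; apply: subm_range.
Qed.

Lemma map_state_ok f i j i' j' st :
  (forall m q e, q \in P -> tracks i j m q e -> tracks i' j' m q (f m e)) ->
  state_ok i j st -> state_ok i' j' (map_state f st).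
Proof.
case: st => D G k f_ok [GQ [GE D_ok GQ_ok [A_uniq A_sub A_size A_small]]].
pose GQ' := [seq (qe.1, f 0 qe.2) | qe <- GQ].
have fstD' : map fst [seq (pe.1, f pe.1 pe.2) | pe <- D] = map fst D by rewrite -map_comp.
have fstG' : map fst GQ' = map fst GQ by rewrite -map_comp.
exists GQ'; split; first by rewrite GE -!map_comp.
- move=> _ /mapP[pe peD ->] /=; apply: f_ok; last exact: D_ok.
  by apply: A_sub; rewrite map_cat mem_cat map_f.
- move=> _ /mapP[pe peG ->] /=; apply: f_ok; last exact: GQ_ok.
  by apply: A_sub; rewrite map_cat mem_cat orbC map_f.
- by rewrite fstD' map_cat fstD' fstG' -map_cat !size_map.
Qed.

Lemma move_fwd_ok b i j st : d j = b -> state_ok i j st ->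
  state_ok i (j + 1) (map_state (fwd_move b) st).
Proof.
move=> db; apply: map_state_ok => m q e qP [linked_e m_ok]; split.
  by apply: linked_fwd => //; case: m_ok => [|[]]; [left|right].
by case: m_ok => [|[-> red_e]]; [left|right; split=> //; apply: reduced_fwd].
Qed.

Lemma move_bwd_ok b i j st : d (i - 1) = b -> state_ok i j st ->
  state_ok (i - 1) j (map_state (bwd_move b) st).
Proof.
move=> db; apply: map_state_ok => m q e qP [linked_e m_ok]; split.
  by apply: linked_bwd => //; case: m_ok => [|[]]; [left|right].
by case: m_ok => [|[-> red_e]]; [left|right; split=> //; apply: reduced_bwd].
Qed.

Definition frame_ok (i j : Z) (w : frame) : Prop :=
  let: Frame al be ga de := w in
  al * de - be * ga = 1 /\ forall q, q \in P ->
    (q | X i - (al * X j + be * Y j)) /\ (q | Y i - (ga * X j + de * Y j)).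

Lemma frame_fwd_ok b i j w : d j = b -> frame_ok i j w -> frame_ok i (j + 1) (fwd_frame b w).
Proof.
case: w => al be ga de db [det w_ok].
have j_step q (qP : q \in P) := (X_step j qP, Y_step j qP).
case: b db j_step => -> j_step; (split; first lia) => q qP;
  have [[Xi Yi] [Xj Yj]] := (w_ok q qP, j_step q qP); split.
- by apply: (divide_lin5 (u1 := 1) (u2 := - al) (u3 := al - be) (u4 := 0) (u5 := 0) Xi Xj Yj Xi Xi); ring.
- by apply: (divide_lin5 (u1 := 1) (u2 := - ga) (u3 := ga - de) (u4 := 0) (u5 := 0) Yi Xj Yj Xi Xi); ring.
- by apply: (divide_lin5 (u1 := 1) (u2 := be - al) (u3 := - be) (u4 := 0) (u5 := 0) Xi Xj Yj Xi Xi); ring.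
- by apply: (divide_lin5 (u1 := 1) (u2 := de - ga) (u3 := - de) (u4 := 0) (u5 := 0) Yi Xj Yj Xi Xi); ring.
Qed.

Lemma frame_bwd_ok b i j w : d (i - 1) = b -> frame_ok i j w -> frame_ok (i - 1) j (bwd_frame b w).
Proof.
case: w => al be ga de db [det w_ok].
have i_step q (qP : q \in P) := (X_step (i - 1) qP, Y_step (i - 1) qP).
rewrite Z.sub_add in i_step.
case: b db i_step => -> i_step; (split; first lia) => q qP;
  have [[Xi Yi] [Xi' Yi']] := (w_ok q qP, i_step q qP); split.
- by apply: (divide_lin5 (u1 := 1) (u2 := - 1) (u3 := - 1) (u4 := 1) (u5 := 0) Xi Yi Xi' Yi' Xi); ring.
- by apply: (divide_lin5 (u1 := 1) (u2 := - 1) (u3 := 0) (u4 := 0) (u5 := 0) Yi Yi' Xi Xi Xi); ring.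
- by apply: (divide_lin5 (u1 := 1) (u2 := - 1) (u3 := 0) (u4 := 0) (u5 := 0) Xi Xi' Xi Xi Xi); ring.
- by apply: (divide_lin5 (u1 := 1) (u2 := - 1) (u3 := - 1) (u4 := 1) (u5 := 0) Yi Xi Yi' Xi' Xi); ring.
Qed.

Lemma fwd_val_evaluates i j : evaluates i j fwd_val (X j + Y j).
Proof.
move=> m q [x y x' y'] qP [[c [xc yc _ _]] m_ok] qw; split.
  have xy : (q | addm m x y - (x + y)) by apply: addm_divide; case: m_ok => [|[]]; [left|right].
  by apply: (divide_lin5 (u1 := 1) (u2 := 1) (u3 := 1) (u4 := c) (u5 := 0) xy xc yc qw xc); rewrite /fwd_val; ring.
move=> mE; have q1 := prime_ge_2 q (P_prime qP).
by case: m_ok => [|[_ []]]; [lia|rewrite mE => *; apply: addm_range].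
Qed.

Lemma bwd_val_evaluates i j : evaluates i j bwd_val (X i - Y i).
Proof.
move=> m q [x y x' y'] qP [[c [_ _ xc yc]] m_ok] qw; split.
  have xy : (q | subm m x' y' - (x' - y')) by apply: subm_divide; case: m_ok => [|[]]; [left|right].
  by apply: (divide_lin5 (u1 := 1) (u2 := 1) (u3 := - 1) (u4 := c) (u5 := 0) xy xc yc qw xc); rewrite /bwd_val; ring.
move=> mE; have q1 := prime_ge_2 q (P_prime qP).
by case: m_ok => [|[_ []]]; [lia|rewrite mE => *; apply: subm_range].
Qed.

Lemma fst_val_evaluates i j : evaluates i j fst_val (X j).
Proof.
move=> m q [x y x' y'] qP [[c [xc _ _ _]] m_ok] qw; split.
  by apply: (divide_lin (u := 1) (v := c) xc qw); rewrite /fst_val; ring.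
move=> mE; have q1 := prime_ge_2 q (P_prime qP).
by case: m_ok => [|[_ []]]; [lia|].
Qed.

Lemma snd_val_evaluates i j : evaluates i j snd_val (Y j).
Proof.
move=> m q [x y x' y'] qP [[c [_ yc _ _]] m_ok] qw; split.
  by apply: (divide_lin (u := 1) (v := c) yc qw); rewrite /snd_val; ring.
move=> mE; have q1 := prime_ge_2 q (P_prime qP).
by case: m_ok => [|[_ []]]; [lia|].
Qed.

Lemma fwd_new_linked i j w q : frame_ok i j w -> q \in P -> (q | X j + Y j) ->
  linked i j q (fwd_new w).
Proof.
case: w => al be ga de [det w_ok] qP qXY; have [Xi Yi] := w_ok q qP.
have qY : ~ (q | Y j).
  move=> qY; apply: (XY_coprime (k := j) qP) => //.
  by apply: (divide_lin (u := 1) (v := - 1) qXY qY); ring.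
have [c cY] := invertible_mod (P_prime qP) qY; exists c; split.
- by apply: (divide_lin (u := - c) (v := - 1) qXY cY); ring.
- exact: cY.
- by apply: (divide_lin5 (u1 := - c) (u2 := - c * al) (u3 := be - al) (u4 := 0) (u5 := 0) Xi qXY cY Xi Xi); ring.
- by apply: (divide_lin5 (u1 := - c) (u2 := - c * ga) (u3 := de - ga) (u4 := 0) (u5 := 0) Yi qXY cY Xi Xi); ring.
Qed.

Lemma bwd_new_linked i j w q : frame_ok i j w -> q \in P -> (q | X i - Y i) ->
  linked i j q (bwd_new w).
Proof.
case: w => al be ga de [det w_ok] qP qXY; have [Xi Yi] := w_ok q qP.
have qY : ~ (q | Y i).
  move=> qY; apply: (XY_coprime (k := i) qP) => //.
  by apply: (divide_lin (u := 1) (v := 1) qXY qY); ring.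
have [c cY] := invertible_mod (P_prime qP) qY; exists c; split.
(* The last summand is a multiple of [al * de - be * ga - 1], which is zero; it makes the equality
   with the goal a polynomial identity. *)
- suff: (q | de * (1 - c * Y i) - be * (1 - c * Y i) - c * de * (X i - Y i)
        + c * de * (X i - (al * X j + be * Y j)) - c * be * (Y i - (ga * X j + de * Y j))
        + c * X j * (al * de - be * ga - 1)).
    by congr (_ | _); ring.
  rewrite det Z.sub_diag Z.mul_0_r Z.add_0_r.
  by apply: (divide_lin5 (u1 := de - be) (u2 := - c * de) (u3 := c * de) (u4 := - c * be) (u5 := 0) cY qXY Xi Yi Xi); ring.
- suff: (q | (al - ga) * (1 - c * Y i) + c * ga * (X i - Y i)
        - c * ga * (X i - (al * X j + be * Y j)) + c * al * (Y i - (ga * X j + de * Y j))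
        + c * Y j * (al * de - be * ga - 1)).
    by congr (_ | _); ring.
  rewrite det Z.sub_diag Z.mul_0_r Z.add_0_r.
  by apply: (divide_lin5 (u1 := al - ga) (u2 := c * ga) (u3 := - c * ga) (u4 := c * al) (u5 := 0) cY qXY Xi Yi Xi); ring.
- by apply: (divide_lin (u := - c) (v := 1) qXY cY); ring.
- exact: cY.
Qed.

Definition fwd_run_ok (j : Z) (r : run) : Prop :=
  let: Run b n := r in forall t : nat, (t < n)%N -> d (j - 1 - Z.of_nat t) = b.

Definition bwd_run_ok (i : Z) (r : run) : Prop :=
  let: Run b n := r in forall t : nat, (t < n)%N -> d (i + Z.of_nat t) = b.

Lemma extend_fwd_ok j r : fwd_run_ok j r -> fwd_run_ok (j + 1) (extend (d j) r).
Proof.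
case: r => c n r_ok [|t] /= tn; first by congr d; lia.
case: eqP tn => [->|//] tn; rewrite -(r_ok t) //; congr d; lia.
Qed.

Lemma extend_bwd_ok i r : bwd_run_ok i r -> bwd_run_ok (i - 1) (extend (d (i - 1)) r).
Proof.
case: r => c n r_ok [|t] /= tn; first by congr d; lia.
case: eqP tn => [->|//] tn; rewrite -(r_ok t) //; congr d; lia.
Qed.

Lemma fwd_run_short j r : fwd_run_ok j r -> short a r.
Proof.
case: r => b n r_ok /=; rewrite leqNgt; apply/negP => an.
apply: (runs_le (k := j - 1 - Z.of_nat a)) => t ta.
rewrite (r_ok a) // -(r_ok (a - t)%N); last by lia.
by congr d; lia.
Qed.

Lemma bwd_run_short i r : bwd_run_ok i r -> short a r.
Proof.
case: r => b n r_ok /=; rewrite leqNgt; apply/negP => an.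
apply: (runs_le (k := i)) => t ta.
by rewrite r_ok; last lia; rewrite -(r_ok 0%N); [congr d; lia|lia].
Qed.

Definition closed_ok (j : Z) (D : seq (Z * Z * Z)) : Prop :=
  {in D, forall t, let: (p, x, y) := t in
     [/\ p \in P, 0 <= x < p, 0 <= y < p &
         exists c, (p | x - c * X j) /\ (p | y - c * Y j)]} /\
  forall q, q \in P -> exists x y, (q, x, y) \in D.

Lemma XY_cover j : exists2 q, q \in P & (q | X j + Y j).
Proof.
case dj: (d j).
  have [q qP qX] := X_cover (j + 1); exists q => //.
  by have := X_step j qP; rewrite dj => qX'; apply: (divide_lin (u := 1) (v := - 1) qX qX'); ring.
have [q qP qY] := Y_cover (j + 1); exists q => //.
by have := Y_step j qP; rewrite dj => qY'; apply: (divide_lin (u := 1) (v := - 1) qY qY'); ring.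
Qed.

Lemma YX_cover i : exists2 q, q \in P & (q | X i - Y i).
Proof.
case di: (d (i - 1)).
  have [q qP qX] := X_cover (i - 1); exists q => //.
  have := X_step (i - 1) qP; have := Y_step (i - 1) qP; rewrite di Z.sub_add => qY' qX'.
  by apply: (divide_lin5 (u1 := 1) (u2 := - 1) (u3 := 1) (u4 := 0) (u5 := 0) qX' qY' qX qX qX); ring.
have [q qP qY] := Y_cover (i - 1); exists q => //.
have := X_step (i - 1) qP; have := Y_step (i - 1) qP; rewrite di Z.sub_add => qY' qX'.
by apply: (divide_lin5 (u1 := 1) (u2 := - 1) (u3 := - 1) (u4 := 0) (u5 := 0) qX' qY' qY qX' qX'); ring.
Qed.

(** The actual walk never dies and never makes a run longer than [a], so the search follows it until
    the fuel is spent. *)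
Lemma closed_search_sound fuel j D r :
  closed_ok j D -> fwd_run_ok j r -> closed_search a fuel D r = false.
Proof.
elim: fuel j D r => [//|n IH] j D r [D_ok D_all] r_ok; rewrite closed_searchS.
have -> : has (fun t : Z * Z * Z => let: (p, x, y) := t in addm p x y =? 0) D.
  have [q qP qXY] := XY_cover j; have [x [y xyD]] := D_all q qP.
  apply/hasP; exists (q, x, y) => //.
  have [_ x_range y_range [c [xc yc]]] := D_ok _ xyD.
  apply/Z.eqb_spec/(divide_range0 (addm_range x_range y_range)).
  have xy : (q | addm q x y - (x + y)) by apply: addm_divide; right.
  by apply: (divide_lin5 (u1 := 1) (u2 := 1) (u3 := 1) (u4 := c) (u5 := 0) xy xc yc qXY xc); ring.
have := extend_fwd_ok r_ok; case dj: (d j) => r_ok'; rewrite (fwd_run_short r_ok').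
  rewrite andbC (IH (j + 1)) //; split.
    move=> _ /mapP[[[p x] y] /D_ok[pP x_range y_range [c [xc yc]]] ->].
    split=> //; first exact: addm_range.
    have xy : (p | addm p x y - (x + y)) by apply: addm_divide; right.
    have := X_step j pP; have := Y_step j pP; rewrite dj => Yj Xj; exists c; split.
      by apply: (divide_lin5 (u1 := 1) (u2 := 1) (u3 := 1) (u4 := - c) (u5 := 0) xy xc yc Xj xc); ring.
    by apply: (divide_lin (u := 1) (v := - c) yc Yj); ring.
  move=> q qP; have [x [y xyD]] := D_all q qP; exists (addm q x y), y.
  by apply/mapP; exists (q, x, y).
rewrite (IH (j + 1)) //; split.
  move=> _ /mapP[[[p x] y] /D_ok[pP x_range y_range [c [xc yc]]] ->].
  split=> //; first exact: addm_range.
  have xy : (p | addm p x y - (x + y)) by apply: addm_divide; right.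
  have := X_step j pP; have := Y_step j pP; rewrite dj => Yj Xj; exists c; split.
    by apply: (divide_lin (u := 1) (v := - c) xc Xj); ring.
  by apply: (divide_lin5 (u1 := 1) (u2 := 1) (u3 := 1) (u4 := - c) (u5 := 0) xy xc yc Yj xc); ring.
move=> q qP; have [x [y xyD]] := D_all q qP; exists x, (addm q x y).
by apply/mapP; exists (q, x, y).
Qed.

Lemma state_closed_ok i j D :
  state_ok i j (State D [::] 0) ->
  closed_ok j [seq let: (p, Entry x y _ _) := pe in (p, x, y) | pe <- D].
Proof.
move=> [GQ [GE D_ok _ []]]; case: GQ GE => // _.
rewrite cats0 !addn0 => A_uniq A_sub A_size _.
split=> [_ /mapP[[p [x y x' y']] peD ->]|q qP].
  have pP : p \in P by apply: A_sub; apply/mapP; exists (p, Entry x y x' y').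
  have [[c [xc yc _ _]] [p0|[_ [? ? _ _]]]] := D_ok _ peD.
    by have := prime_ge_2 p (P_prime pP); move: p0 => /=; lia.
  by split=> //; exists c.
have: q \in map fst D.
  by have [|_ ->] := uniq_min_size A_uniq A_sub; rewrite ?size_map.
case/mapP => -[p [x y x' y']] peD /= ->; exists x, y.
by apply/mapP; exists (p, Entry x y x' y').
Qed.

(** Some branch of the search follows the actual walk, and this branch cannot die. So [true] is
    possible only if the correct state was discarded, that is, if [P] contains a listed set. *)
Lemma search_sound fuel st w rf rb i j :
  state_ok i j st -> frame_ok i j w -> fwd_run_ok j rf -> bwd_run_ok i rb ->
  search a fuel st w rf rb -> contained.
Proof.
elim: fuel st w rf rb i j => [//|n IH] st w rf rb i j st_ok w_ok rf_ok rb_ok.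
have opt_f f : all f (options fwd_val (fwd_new w) st) ->
    contained \/ exists2 st', state_ok i j st' & f st'.
  apply: (options_sound (@fwd_val_evaluates i j)) => // [q qP|]; last exact: XY_cover.
  exact: fwd_new_linked.
have opt_b f : all f (options bwd_val (bwd_new w) st) ->
    contained \/ exists2 st', state_ok i j st' & f st'.
  apply: (options_sound (@bwd_val_evaluates i j)) => // [q qP|]; last exact: YX_cover.
  exact: bwd_new_linked.
case: st st_ok opt_f opt_b => D G k st_ok opt_f opt_b /=; case: ifP => [Gk|_].
  case: k G Gk st_ok {opt_f} opt_b => [|//] [|//] _ /state_closed_ok D_ok opt_b.
  rewrite (closed_search_sound _ D_ok) //; case: ifP => // no_cover _.
  (* Nothing covers the entry to the left and no prime is left to choose, so the list of options is
     empty and [pred0] holds on all of it. *)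
  by have [|//|[st' _ //]] := opt_b pred0; first by rewrite /options no_cover.
case: ifP => [/nilP F0 _|_].
  by have [|//|[st' _ //]] := opt_f pred0; first by rewrite F0.
case: ifP => _; rewrite /= andbT => /andP[].
  have := extend_fwd_ok rf_ok.
  case dj: (d j) => rf_ok'; rewrite (fwd_run_short rf_ok') => srch0 srch1.
    have [//|[st' st'_ok]] := opt_f _ srch1; apply: (IH _ _ _ _ i (j + 1)) => //.
      exact: move_fwd_ok.
    exact: frame_fwd_ok.
  have [//|[st' st'_ok]] := opt_f _ srch0; apply: (IH _ _ _ _ i (j + 1)) => //.
    exact: move_fwd_ok.
  exact: frame_fwd_ok.
have := extend_bwd_ok rb_ok.
case di: (d (i - 1)) => rb_ok'; rewrite (bwd_run_short rb_ok') => srch0 srch1.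
  have [//|[st' st'_ok]] := opt_b _ srch1; apply: (IH _ _ _ _ (i - 1) j) => //.
    exact: move_bwd_ok.
  exact: frame_bwd_ok.
have [//|[st' st'_ok]] := opt_b _ srch0; apply: (IH _ _ _ _ (i - 1) j) => //.
  exact: move_bwd_ok.
exact: frame_bwd_ok.
Qed.

Lemma start_points_sound (f : seq (Z * entry) -> bool) (S : seq Z) i :
  {subset S <= P} -> all f (start_points S) ->
  exists D, [/\ map fst D = S, {in D, forall pe, tracks i i pe.1 pe.1 pe.2} & f D].
Proof.
elim: S f => [|p S IH] f SP; first by rewrite /= andbT => f0; exists [::].
have pP : p \in P by apply: SP; rewrite mem_head.
have p_pr := P_prime pP; have p2 := prime_ge_2 p p_pr.
have [pe pe_in [pe1 pe_ok]] : exists2 pe, pe \in points p &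
    pe.1 = p /\ tracks i i pe.1 pe.1 pe.2.
  have [qY|qY] := Zdivide_dec p (Y i).
    have qX : ~ (p | X i) by move=> qX; exact: (XY_coprime pP qX qY).
    have [c cX] := invertible_mod p_pr qX.
    exists (p, Entry 1 0 1 0); first by rewrite mem_head.
    split=> //; split=> /=; last by right; split=> //; split; lia.
    by exists c; split=> //; apply: (divide_lin (u := - c) (v := 0) qY qY); ring.
  have [c cY] := invertible_mod p_pr qY.
  have t_range := Z.mod_pos_bound (c * X i) p ltac:(lia).
  exists (p, Entry ((c * X i) mod p) 1 ((c * X i) mod p) 1).
    rewrite inE; apply/orP; right; apply/mapP; exists (Z.to_nat ((c * X i) mod p)).
      by rewrite mem_iota; lia.
    by rewrite Z2Nat.id //; lia.
  split=> //; split=> /=; last by right; split=> //; split; lia.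
  have tX : (p | (c * X i) mod p - c * X i).
    by exists (- (c * X i / p)); rewrite Z.mod_eq; lia.
  by exists c.
rewrite -[start_points _]/(flatten
  [seq [seq pe' :: D | D <- start_points S] | pe' <- points p]).
rewrite all_flatten all_map => /allP/(_ pe pe_in).
rewrite -[preim _ _ _]/(all _ _) all_map => all_f.
have [|D [D_S D_ok fD]] := IH (preim (cons pe) f) _ all_f.
  by move=> q qS; apply: SP; rewrite inE qS orbT.
exists (pe :: D); split=> //=; first by rewrite pe1 D_S.
by move=> pe'; rewrite inE => /predU1P[->|/D_ok].
Qed.

(** The list contains a correct description of the walk unless that was discarded. Quantifying over
    [f] composes with the nested [flatten] and [map]. *)
Definition witnessed (i j : Z) (l : seq (state * frame)) : Prop :=
  forall f, all f l -> contained \/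
    exists sw, [/\ state_ok i j sw.1, frame_ok i j sw.2 & f sw].

Lemma fwd_word_step_witnessed i j l :
  witnessed i j l -> witnessed i (j + 1) (fwd_word_step l (d j)).
Proof.
move=> l_ok f; rewrite /fwd_word_step all_flatten all_map.
case/l_ok => [|[[st w] [st_ok w_ok]]] /=; first by left.
rewrite all_map => all_f.
have [] := options_sound (@fwd_val_evaluates i j) _ (XY_cover j) st_ok all_f.
- by move=> q qP; exact: fwd_new_linked.
- by left.
case=> st' st'_ok /= f_st'; right; exists (map_state (fwd_move (d j)) st', fwd_frame (d j) w).
by split=> //; [exact: move_fwd_ok|exact: frame_fwd_ok].
Qed.

Hypothesis P_size : (size P <= 6)%N.

Let S := [seq p <- [:: 2; 3; 5] | p \in P].

Lemma small_primes_small : S \in small_sets.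
Proof. by rewrite /S /=; do 3!case: ifP. Qed.

Lemma start_states_witnessed i :
  witnessed i i [seq (st, Frame 1 0 0 1) | st <- start_states S (6 - size S)].
Proof.
move=> f; rewrite all_map /start_states all_flatten all_map => all_f.
have SP : {subset S <= P} by move=> p; rewrite mem_filter => /andP[].
have w_ok : frame_ok i i (Frame 1 0 0 1).
  by split=> // q _; split; [exists 0|exists 0]; ring.
have opt1 st : state_ok i i st -> all (preim (options snd_val (Entry (-1) 0 (-1) 0))
     (all (preim (fun st => (st, Frame 1 0 0 1)) f))) (options fst_val (Entry 0 1 0 1) st) ->
   contained \/ exists sw, [/\ state_ok i i sw.1, frame_ok i i sw.2 & f sw].
  move=> st_ok all1.
  have [] := options_sound (@fst_val_evaluates i i) _ (X_cover i) st_ok all1.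
  - move=> q qP qX; have qY : ~ (q | Y i) by move=> qY; exact: (XY_coprime qP qX qY).
    have [c cY] := invertible_mod (P_prime qP) qY; exists c.
    by split=> //; apply: (divide_lin (u := - c) (v := 0) qX qX); ring.
  - by left.
  case=> st1 st1_ok /= all2.
  have [] := options_sound (@snd_val_evaluates i i) _ (Y_cover i) st1_ok all2.
  - move=> q qP qY; have qX : ~ (q | X i) by move=> qX; exact: (XY_coprime qP qX qY).
    have [c cX] := invertible_mod (P_prime qP) qX; exists (- c).
    split; try by apply: (divide_lin (u := c) (v := 0) qY qY); ring.
      by apply: (divide_lin (u := - 1) (v := 0) cX cX); ring.
    by apply: (divide_lin (u := - 1) (v := 0) cX cX); ring.
  - by left.
  by case=> st2 st2_ok /= f2; right; exists (st2, Frame 1 0 0 1).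
move: all_f; rewrite all_flatten !all_map => all_f.
have [D [D_S D_ok /=]] := start_points_sound i SP all_f.
apply: opt1; exists [::]; rewrite cats0 D_S; split=> //; split=> //.
- by rewrite filter_uniq.
- have -> : size D = size S by rewrite -D_S size_map.
  have : (size S <= 3)%N by rewrite (leq_trans (size_subseq (filter_subseq _ _))).
  by rewrite addn0 => S3; apply: leq_trans P_size _; rewrite subnKC // (leq_trans S3).
- move=> p pP p5; have := prime_ge_2 p (P_prime pP); rewrite mem_filter pP => p2.
  have [|[|[|]]] : p = 2 \/ p = 3 \/ p = 4 \/ p = 5 by lia.
  + by move=> ->.
  + by move=> ->.
  + move=> p4; have := P_prime pP; rewrite p4 => pr4.
    by have := prime_divisors 4 pr4 2 (ex_intro _ 2 erefl); lia.
  + by move=> ->.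
Qed.

Lemma word_states_witnessed i (u : seq bool) :
  (forall n : nat, (n < size u)%N -> d (i + Z.of_nat n) = nth false u n) ->
  witnessed i (i + Z.of_nat (size u)) (word_states S (6 - size S) u).
Proof.
elim/last_ind: u => [|u b IH] u_ok; first by rewrite Z.add_0_r; exact: start_states_witnessed.
rewrite /word_states foldl_rcons size_rcons.
have -> : i + Z.of_nat (size u).+1 = i + Z.of_nat (size u) + 1 by lia.
have <- : d (i + Z.of_nat (size u)) = b by rewrite u_ok ?size_rcons// nth_rcons ltnn eqxx.
apply: fwd_word_step_witnessed; apply: IH => n n_lt.
by rewrite u_ok ?size_rcons ?nth_rcons ?n_lt//; lia.
Qed.

Lemma anchored_search_sound i : anchored_search a S (6 - size S) ->
  d i -> (forall n : nat, (n < a)%N -> d (i + 1 + Z.of_nat n) = false) ->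
  d (i + 1 + Z.of_nat a) -> contained.
Proof.
move=> srch di d_run dia.
set u := true :: rcons (nseq a false) true.
have u_size : size u = a.+2 by rewrite /= size_rcons size_nseq.
have [] := word_states_witnessed (i := i) (u := u) _ srch.
- move=> [|n]; rewrite u_size => n_lt; first by rewrite Z.add_0_r di.
  rewrite /u /= nth_rcons size_nseq nth_nseq; have [na|na] := ltnP n a.
    by rewrite -(d_run n na); congr d; lia.
  have -> : n = a by lia.
  by rewrite eqxx -[true]dia; congr d; lia.
- by [].
case=> -[st w] [st_ok w_ok]; apply: search_sound st_ok w_ok _ _.
  case=> [|//] _; rewrite u_size -[true]dia; congr d; lia.
by case=> [|//] _; rewrite Z.add_0_r.
Qed.

Lemma long_run_contained i : no_long_run ->
  (forall n : nat, (n < 13)%N -> d (i + Z.of_nat n) = false) -> contained.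
Proof.
move=> /allP/(_ S small_primes_small)/nilP no_run d_run.
have W := @word_states_witnessed i (nseq 13 false) _.
have [|||[sw []]//] := W _ pred0 _; last by [].
  by move=> n; rewrite size_nseq => n_lt; rewrite nth_nseq if_same d_run.
by rewrite no_run.
Qed.

End Soundness.

(** * Walks in additive prime trees *)

Local Open Scope classical_set_scope.

Section Walks.
Local Open Scope nat_scope.
Implicit Types (P Q S : {fset nat}) (z w : nat * nat) (b : bool).

Definition child b z : nat * nat :=
  if b then (z.1 + z.2, z.2) else (z.1, z.1 + z.2).

Definition alive P z : Prop :=
  exists p p', [/\ p \in P, p' \in P, p %| z.1 & p' %| z.2].

Definition unit_gcd P z : Prop := gcdn (gcdn z.1 z.2) (primes_prod P) = 1.

Definition walk P (s : nat -> nat * nat) (d : nat -> bool) : Prop :=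
  forall n, [/\ s n.+1 = child (d n) (s n), alive P (s n) & unit_gcd P (s n)].

Lemma gcdn_child b z : gcdn (child b z).1 (child b z).2 = gcdn z.1 z.2.
Proof. by case: b; rewrite /= ?gcdnDl // gcdnC gcdnDr gcdnC. Qed.

Lemma APT_inv P z w : APT P z.1 z.2 w ->
  w = z \/ [/\ alive P z, unit_gcd P z &
             exists b, APT P (child b z).1 (child b z).2 w].
Proof.
case: z => x y /=; elim=> [|X Y _ IH XY_gcd XY_alive|X Y _ IH XY_gcd XY_alive].
- by left.
- right; case: IH => [[<- <-]|[z_alive z_gcd [b zw]]].
    by split=> //; exists false; exact: APT_root.
  by split=> //; exists b; exact: APT_left.
- right; case: IH => [[<- <-]|[z_alive z_gcd [b zw]]].
    by split=> //; exists true; exact: APT_root.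
  by split=> //; exists b; exact: APT_right.
Qed.

Lemma APT_step P z w b : APT P z.1 z.2 w -> alive P w -> unit_gcd P w ->
  APT P z.1 z.2 (child b w).
Proof.
by case: w => X Y zw w_alive w_gcd; case: b; [apply: APT_right|apply: APT_left].
Qed.

(** König's lemma: [big] marks the nodes with infinite subtree, and a big node has a big child. *)
Lemma infinite_type_walk P : infinite_type P ->
  exists s d, [/\ walk P s d, 0 < (s 0).1 & 0 < (s 0).2].
Proof.
move=> P_inf; pose big z := ~ finite_set [set w | APT P z.1 z.2 w].
have [z0 [z0_big x0 y0]] : exists z, [/\ big z, 0 < z.1 & 0 < z.2].
  apply: contrapT => no_big; apply: P_inf => x y x0 y0; apply: contrapT => xy_big.
  by apply: no_big; exists (x, y).
have big_alive z : big z -> alive P z /\ unit_gcd P z.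
  move=> z_big; apply: contrapT => z_dead; apply: z_big.
  apply: (sub_finite_set (B := [set z])); last exact: finite_set1.
  by move=> w /= /APT_inv[->//|[z_alive z_gcd _]]; case: z_dead.
have /choice[d d_big] : forall z, exists b, big z -> big (child b z).
  move=> z.
  have [z1_big|z1_small] := pselect (big (child true z)); first by exists true.
  exists false => z_big z0_small; apply: z_big.
  apply: (@sub_finite_set _ _ ([set z] `|` [set w | APT P (child true z).1 (child true z).2 w]
     `|` [set w | APT P (child false z).1 (child false z).2 w])).
    by move=> w /= /APT_inv[->|[_ _ [[] zw]]]; [left; left|left; right|right].
  rewrite !finite_setU; split=> //; split; first exact: finite_set1.
  exact: contrapT z1_small.
pose s n := iter n (fun z => child (d z) z) z0.
exists s, (d \o s); split=> // n.
have sn_big : big (s n) by elim: n => //= n IH; exact: d_big.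
by have [] := big_alive _ sn_big.
Qed.

Lemma child_mod N b z w : z.1 = w.1 %[mod N] -> z.2 = w.2 %[mod N] ->
  (child b z).1 = (child b w).1 %[mod N] /\ (child b z).2 = (child b w).2 %[mod N].
Proof.
by move=> zw1 zw2; case: b; split=> //=; rewrite -modnDm zw1 zw2 modnDm.
Qed.

Lemma dvdn_primes_prod P p : p \in P -> p %| primes_prod P.
Proof.
move=> pP; rewrite /primes_prod (big_rem p) /=; first exact: dvdn_mulr.
exact: pP.
Qed.

Lemma dvdn_eq_mod p x y : x = y %[mod p] -> (p %| x) = (p %| y).
Proof. by move=> xy; rewrite /dvdn xy. Qed.

Lemma primes_prod_gt0 P : prime_fset P -> 0 < primes_prod P.
Proof.
move=> P_prime; rewrite /primes_prod big_seq prodn_cond_gt0 // => p pP.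
exact/prime_gt0/P_prime.
Qed.

Definition congruent S z w : Prop :=
  forall p, p \in S -> z.1 = w.1 %[mod p] /\ z.2 = w.2 %[mod p].

Lemma congruent_sym S z w : congruent S z w -> congruent S w z.
Proof. by move=> zw p /zw[]. Qed.

Lemma congruent_child S b z w : congruent S z w -> congruent S (child b z) (child b w).
Proof. by move=> zw p /zw[? ?]; exact: child_mod. Qed.

Lemma alive_congruent S z w : congruent S z w -> alive S z -> alive S w.
Proof.
move=> zw [p [p' [pS p'S pz p'z]]]; exists p, p'; split=> //.
  by have [/dvdn_eq_mod <-] := zw _ pS.
by have [_ /dvdn_eq_mod <-] := zw _ p'S.
Qed.

(** Repeating the directions of the closed walk keeps its residues modulo the primes of [S], so
    every pair stays alive, while the steps preserve the gcd. The sums of coordinates increase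
    strictly, so the nodes are distinct. *)
Lemma cycle_infinite_type S Q (s : nat -> nat * nat) (d : nat -> bool) m :
  (S `<=` Q)%fset -> 0 < m -> 0 < (s 0).1 -> 0 < (s 0).2 -> unit_gcd Q (s 0) ->
  (forall i, i < m -> s i.+1 = child (d i) (s i) /\ alive S (s i)) ->
  congruent S (s m) (s 0) -> infinite_type Q.
Proof.
move=> SQ m0 x0 y0 s0_gcd s_step sm Q_fin.
pose t := fix t n := if n is n'.+1 then child (d (n' %% m)) (t n') else s 0.
have t_mod n : congruent S (t n) (s (n %% m)).
  elim: n => [|n IH]; first by rewrite mod0n.
  have nm := ltn_pmod n m0; have [sn _] := s_step _ nm.
  have := congruent_child (d (n %% m)) IH; rewrite -sn -[child _ (t n)]/(t n.+1).
  have -> : n.+1 %% m = (n %% m).+1 %% m by rewrite -addn1 -modnDml addn1.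
  move: nm; rewrite leq_eqVlt => /predU1P[->|/modn_small->//].
  by rewrite modnn => tn p pS; have [-> ->] := tn p pS; exact: sm.
have t_alive n : alive Q (t n).
  have [_ s_alive] := s_step _ (ltn_pmod n m0).
  have [p [p' [pS p'S pt p't]]] := alive_congruent (congruent_sym (t_mod n)) s_alive.
  by exists p, p'; split=> //; apply: (fsubsetP SQ).
have t_gcd n : unit_gcd Q (t n).
  by elim: n => //= n IH; rewrite /unit_gcd gcdn_child.
have t_APT n : APT Q (s 0).1 (s 0).2 (t n).
  by elim: n => [|n IH]; [rewrite /=; case: (s 0); exact: APT_root|exact: APT_step].
have t_pos n : 0 < (t n).1 /\ 0 < (t n).2.
  by elim: n => //= n [t1 t2]; case: (d _) => /=; lia.
have t_mono : {homo (fun n => (t n).1 + (t n).2) : i j / i < j}.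
  apply: homo_ltn; first exact: ltn_trans.
  by move=> n /=; have [t1 t2] := t_pos n; case: (d _) => /=; lia.
have t_inj : injective t.
  by move=> i j tij; case: (ltngtP i j) => // /t_mono; rewrite tij ltnn.
apply: infinite_nat.
rewrite -[setT]/(t @^-1` setT); have := Q_fin _ _ x0 y0.
move=> /(finite_preimage (f := t)) -/(_ (in2W t_inj)); apply: sub_finite_set => n _.
exact: t_APT.
Qed.

Lemma residue_repeat (s : nat -> nat * nat) N : 0 < N ->
  exists i j, [/\ i < j, j <= N * N, (s i).1 = (s j).1 %[mod N] & (s i).2 = (s j).2 %[mod N]].
Proof.
move=> N0; pose f (i : 'I_(N * N).+1) : 'I_N * 'I_N :=
  (Ordinal (ltn_pmod (s i).1 N0), Ordinal (ltn_pmod (s i).2 N0)).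
have /injectivePn[i [j ij fij]] : ~~ injectiveb f.
  by apply/negP => /injectiveP/leq_card; rewrite card_prod !card_ord ltnn.
have f1 : (s i).1 = (s j).1 %[mod N] by case: fij.
have f2 : (s i).2 = (s j).2 %[mod N] by case: fij.
case: (ltngtP i j) => [lt_ij|lt_ji|/val_inj eq_ij]; last by rewrite eq_ij eqxx in ij.
  by exists i, j; split=> //; rewrite -ltnS.
by exists j, i; split=> //; rewrite -ltnS.
Qed.

End Walks.

(** * Infinite type sets of at most six primes *)

Section ZWalk.
Local Open Scope Z_scope.

Lemma divide_of_nat (m n : nat) : (Z.of_nat m | Z.of_nat n) <-> (m %| n)%N.
Proof.
split=> [[c nE]|/dvdnP[k ->]]; last by exists (Z.of_nat k); lia.
have [c0|c0] := Z.le_gt_cases 0 c; last by have -> : n = 0%N by nia.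
by apply/dvdnP; exists (Z.to_nat c); nia.
Qed.

Lemma prime_of_nat (p : nat) : prime p -> Znumtheory.prime (Z.of_nat p).
Proof.
move=> p_pr; apply/prime_alt; split=> [|n n_range]; first by have := prime_gt1 p_pr; lia.
rewrite -(Z2Nat.id n) ?divide_of_nat => [np|]; last lia.
by have [_ /(_ _ np)/orP[]/eqP] := primeP p_pr; lia.
Qed.

Lemma anchored_searchT a S : S \in small_sets -> (0 < a <= 12)%N ->
  anchored_search a S (6 - size S).
Proof.
suff main : search_succeeds -> S \in small_sets -> (0 < a <= 12)%N ->
  anchored_search a S (6 - size S) by exact: (main search_succeedsT).
rewrite /search_succeeds => succ S_in a_range.
have {succ} := allP succ S S_in; move/allP; apply.
by rewrite mem_iota; lia.
Qed.

(** A maximal run length [a] exists because runs have at most 12 steps, and by maximality both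
    neighbours of such a run go the other way. The anchor [i] is the step just before it. *)
Lemma max_run_anchor (d : Z -> bool) :
  (forall i, ~ (forall n : nat, (n < 13)%N -> d (i + Z.of_nat n) = d i)) ->
  exists a i, [/\ (0 < a <= 12)%N,
    forall k, ~ (forall t : nat, (t <= a)%N -> d (k + Z.of_nat t) = d k),
    forall n : nat, (n < a)%N -> d (i + 1 + Z.of_nat n) = ~~ d i &
    d (i + 1 + Z.of_nat a) = d i].
Proof.
move=> no13.
pose is_run a := `[< exists k, forall t : nat, (t < a)%N -> d (k + Z.of_nat t) = d k >].
have run1 : is_run 1%N.
  by apply/asboolP; exists 0 => -[|//] _; congr d; lia.
have run_le a : is_run a -> (a <= 12)%N.
  move=> /asboolP[k k_run]; rewrite leqNgt; apply/negP => a13.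
  by apply: (no13 k) => n n13; apply: k_run; lia.
case: (ex_maxnP (ex_intro is_run 1%N run1) run_le) => a a_run a_max.
have a_gt0 := a_max _ run1.
have no_longer k : ~ (forall t : nat, (t <= a)%N -> d (k + Z.of_nat t) = d k).
  move=> k_run; suff /a_max : is_run a.+1 by rewrite ltnn.
  by apply/asboolP; exists k.
have /asboolP[k k_run] := a_run.
have d_pred : d (k - 1) = ~~ d k.
  apply/eqP/negP => dk; apply: (no_longer (k - 1)).
  have {}dk : d (k - 1) = d k by case: (d k) (d (k - 1)) dk => -[].
  case=> [|t] ta; first by congr d; lia.
  by rewrite dk -(k_run t) //; congr d; lia.
have d_succ : d (k + Z.of_nat a) = ~~ d k.
  apply/eqP/negP => dk; apply: (no_longer k) => t.
  have {}dk : d (k + Z.of_nat a) = d k by case: (d k) (d (k + _)) dk => -[].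
  by rewrite leq_eqVlt => /predU1P[->//|/k_run].
exists a, (k - 1); split=> //.
- by rewrite a_gt0 run_le.
- by move=> n n_a; rewrite d_pred negbK -(k_run n) //; congr d; lia.
- by rewrite d_pred -d_succ; congr d; lia.
Qed.

(** Two pairs of the infinite walk agree modulo the product of [P]. The segment between them is
    repeated in both directions by [ix], which gives the two-sided walk that the search is about. *)
Lemma small_infinite_contains_known (P : {fset nat}) :
  prime_fset P -> (#|` P| <= 6)%N -> infinite_type P ->
  exists2 K, K \in known_sets & forall p, p \in K -> Z.to_nat p \in P.
Proof.
move=> P_prime P_size /infinite_type_walk[s [d [s_walk _ _]]].
have N0 := primes_prod_gt0 P_prime.
have [i [j [ij _ s1 s2]]] := residue_repeat s N0.
pose T := Z.of_nat (j - i).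
have T0 : 0 < T by rewrite /T; lia.
pose ix k := (i + Z.to_nat (k mod T))%N.
have ix_succ k : ix (k + 1) = (ix k).+1 \/ (ix k).+1 = j /\ ix (k + 1) = i.
  have k_range := Z.mod_pos_bound k T T0.
  have kE := Z.div_mod k T ltac:(lia).
  have [lt_T|ge_T] := Z.lt_ge_cases (k mod T + 1) T; [left|right].
    have : k mod T + 1 = (k + 1) mod T by apply: (Z.mod_unique_pos _ _ (k / T)); lia.
    by rewrite /ix => <-; lia.
  have : 0 = (k + 1) mod T by apply: (Z.mod_unique_pos _ _ (k / T + 1)); lia.
  have rE : k mod T = T - 1 by lia.
  by rewrite /ix rE => <-; rewrite /T; lia.
pose X k := Z.of_nat (s (ix k)).1; pose Y k := Z.of_nat (s (ix k)).2.
pose e k := d (ix k).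
pose PZ := map Z.of_nat P.
have PZP q : q \in PZ -> exists2 p, p \in P & q = Z.of_nat p.
  by case/mapP => p pP ->; exists p.
have PZ_uniq : uniq PZ by rewrite map_inj_uniq ?fset_uniq //; exact: Nat2Z.inj.
have PZ_prime q : q \in PZ -> Znumtheory.prime q.
  by case/PZP => p pP ->; apply/prime_of_nat/P_prime.
have ix_mod k : (s (ix (k + 1))).1 = (s (ix k).+1).1 %[mod primes_prod P] /\
                (s (ix (k + 1))).2 = (s (ix k).+1).2 %[mod primes_prod P].
  by case: (ix_succ k) => [->//|[-> ->]].
have Z_mod p x y : p \in P -> x = y %[mod primes_prod P] ->
    (Z.of_nat p | Z.of_nat x - Z.of_nat y).
  move=> pP xy; have {}xy : x = y %[mod p].
    by rewrite -(modn_dvdm x (dvdn_primes_prod pP)) xy modn_dvdm ?dvdn_primes_prod.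
  exists (Z.of_nat (x %/ p) - Z.of_nat (y %/ p)).
  by rewrite {1}(divn_eq x p) {1}(divn_eq y p) xy; lia.
have X_step q k : q \in PZ -> (q | X (k + 1) - (if e k then X k + Y k else X k)).
  case/PZP => p pP ->; have [sk _ _] := s_walk (ix k); have [sk1 _] := ix_mod k.
  have := Z_mod p _ _ pP sk1; rewrite sk /X /Y /e; case: (d _) => //=.
  by congr (_ | _); lia.
have Y_step q k : q \in PZ -> (q | Y (k + 1) - (if e k then Y k else X k + Y k)).
  case/PZP => p pP ->; have [sk _ _] := s_walk (ix k); have [_ sk2] := ix_mod k.
  have := Z_mod p _ _ pP sk2; rewrite sk /X /Y /e; case: (d _) => //=.
  by congr (_ | _); lia.
have XY_coprime q k : q \in PZ -> (q | X k) -> (q | Y k) -> False.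
  case/PZP => p pP -> /divide_of_nat pX /divide_of_nat pY.
  have [_ _ s_gcd] := s_walk (ix k).
  have : (p %| 1)%N by rewrite -s_gcd !dvdn_gcd pX pY dvdn_primes_prod.
  by rewrite dvdn1 => /eqP p1; have := P_prime _ pP; rewrite p1.
have XY_cover k : (exists2 q, q \in PZ & (q | X k)) /\ (exists2 q, q \in PZ & (q | Y k)).
  have [_ [p [p' [pP p'P pX p'Y]]] _] := s_walk (ix k).
  by split; [exists (Z.of_nat p)|exists (Z.of_nat p')]; rewrite ?map_f //; exact/divide_of_nat.
have contained_known : contained PZ -> exists2 K, K \in known_sets & forall p, p \in K -> Z.to_nat p \in P.
  move=> [K K_known K_sub]; exists K => // p /K_sub/PZP[p' p'P ->].
  by rewrite Nat2Z.id.
apply: contained_known.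
have PZ_size : (size PZ <= 6)%N by rewrite size_map.
apply: contrapT => not_contained.
have [|a [k [a_range runs_le k_run k_end]]] := @max_run_anchor e.
  move=> k k_run; apply: not_contained; case ek: (e k).
    (* A run of [true] becomes a run of [false] when the coordinates are exchanged. *)
    apply: (@long_run_contained PZ Y X (fun k => ~~ e k) PZ_uniq PZ_prime _ _ _ _ _ PZ_size k no_long_runT).
    - by move=> q l qP; have := Y_step q l qP; rewrite /=; case: (e l) => //=; rewrite (Z.add_comm (X l)).
    - by move=> q l qP; have := X_step q l qP; rewrite /=; case: (e l) => //=; rewrite (Z.add_comm (X l)).
    - by move=> q l qP qY qX; exact: (XY_coprime q l).
    - by move=> l; have [] := XY_cover l.
    - by move=> l; have [] := XY_cover l.
    - by move=> n n13; rewrite k_run ?ek.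
  apply: (@long_run_contained PZ X Y e PZ_uniq PZ_prime _ _ _ _ _ PZ_size k no_long_runT) => //.
  - by move=> l; have [] := XY_cover l.
  - by move=> l; have [] := XY_cover l.
  - by move=> n n13; rewrite k_run ?ek.
have srch : anchored_search a [seq p <- [:: 2; 3; 5] | p \in PZ] (6 - size [seq p <- [:: 2; 3; 5] | p \in PZ]).
  by apply: anchored_searchT => //; exact: small_primes_small.
apply: not_contained; case ek: (e k); rewrite ek in k_run k_end.
  apply: (@anchored_search_sound PZ X Y e a PZ_uniq PZ_prime _ _ _ _ _ runs_le PZ_size k srch) => //.
  - by move=> l; have [] := XY_cover l.
  - by move=> l; have [] := XY_cover l.
apply: (@anchored_search_sound PZ Y X (fun k => ~~ e k) a PZ_uniq PZ_prime _ _ _ _ _ _ PZ_size k srch) => //=.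
- by move=> q l qP; have := Y_step q l qP; rewrite /=; case: (e l) => //=; rewrite (Z.add_comm (X l)).
- by move=> q l qP; have := X_step q l qP; rewrite /=; case: (e l) => //=; rewrite (Z.add_comm (X l)).
- by move=> q l qP qY qX; exact: (XY_coprime q l).
- by move=> l; have [] := XY_cover l.
- by move=> l; have [] := XY_cover l.
- by move=> l l_run; apply: (runs_le l) => t ta; apply: negb_inj; exact: l_run.
- by rewrite ek.
- by move=> n n_a; rewrite k_run.
- by rewrite k_end.
Qed.
End ZWalk.

(** * Finiteness of the primitive sets of given size *)

Section Extension.
Local Open Scope nat_scope.
Implicit Types (P Q S : {fset nat}) (s : nat -> nat * nat) (d : nat -> bool).

(** If the [k] found for [l] fails at [p], then [k + N] works, with [N] the product of [l]: the
    shift by N X is invisible to [l] and not divisible by [p], since p | X would give p | Y. *)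
Lemma avoid_primes (l : seq nat) X Y : uniq l -> all prime l ->
  (forall p, p \in l -> p %| X -> p %| Y -> False) ->
  exists2 k, k < \prod_(p <- l) p & forall p, p \in l -> ~~ (p %| Y + k * X).
Proof.
elim: l => [|p l IH] /=; first by exists 0; rewrite ?big_nil.
move=> /andP[pl l_uniq] /andP[p_pr l_prime] XY.
have [|k k_lt k_ok] := IH l_uniq l_prime; first by move=> q ql; apply: XY; rewrite inE ql orbT.
set N := \prod_(q <- l) q in k_lt *; rewrite big_cons -/N.
have p2 := prime_gt1 p_pr.
have [pk|pk] := boolP (p %| Y + k * X); last first.
  exists k; first by nia.
  by move=> q; rewrite inE => /predU1P[->//|/k_ok].
exists (k + N); first by nia.
have kN : Y + (k + N) * X = Y + k * X + N * X by rewrite mulnDl addnA.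
move=> q; rewrite inE kN => /predU1P[->|ql].
  rewrite (dvdn_addr _ pk) Euclid_dvdM // negb_or; apply/andP; split.
    rewrite /N Euclid_dvd_prod //; rewrite big_has -all_predC; apply/allP => q' ql /=.
    rewrite (dvdn_prime2 p_pr (allP l_prime _ ql)); apply/eqP => pq.
    by rewrite pq ql in pl.
  apply/negP => pX; apply: (XY p (mem_head _ _) pX).
  by move: pk; rewrite dvdn_addl // dvdn_mull.
rewrite dvdn_addl ?k_ok // dvdn_mulr //.
by rewrite /N (big_rem q) //= dvdn_mulr.
Qed.

Lemma unit_gcdP P z p : unit_gcd P z -> p \in P -> prime p ->
  p %| z.1 -> p %| z.2 -> False.
Proof.
move=> z_gcd pP p_pr p1 p2; have : p %| 1.
  by rewrite -z_gcd !dvdn_gcd p1 p2 dvdn_primes_prod.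
by rewrite dvdn1 => /eqP p_eq1; rewrite p_eq1 in p_pr.
Qed.

Definition steps s d : Prop := forall n, s n.+1 = child (d n) (s n).

(** The entry created by the step from [s n], whatever its direction. *)
Definition new s n : nat := (s n).1 + (s n).2.

Definition covered P n : Prop := exists2 p, p \in P & p %| n.

Lemma steps_pos s d n : steps s d -> 0 < (s 0).1 -> 0 < (s 0).2 ->
  0 < (s n).1 /\ 0 < (s n).2.
Proof.
by move=> s_step x0 y0; elim: n => //= n [? ?]; rewrite s_step; case: (d n) => /=; lia.
Qed.

(** Among N N + 1 consecutive pairs, with N the product of [S], two agree modulo N, and the alive
    walk between them is a cycle. *)
Lemma alive_segment S s d n : prime_fset S -> steps s d ->
  0 < (s n).1 -> 0 < (s n).2 -> (forall m, unit_gcd S (s m)) ->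
  (forall m, n <= m < n + primes_prod S * primes_prod S -> alive S (s m)) ->
  infinite_type S.
Proof.
move=> S_prime s_step x0 y0 s_gcd s_alive.
have N0 := primes_prod_gt0 S_prime.
have [i [j [ij jN s1 s2]]] := residue_repeat (fun m => s (n + m)) N0.
have [xi yi] : 0 < (s (n + i)).1 /\ 0 < (s (n + i)).2.
  have := @steps_pos (fun m => s (n + m)) (fun m => d (n + m)) i.
  by rewrite addn0; apply=> // m; rewrite addnS s_step.
apply: (@cycle_infinite_type S S (fun m => s (n + i + m)) (fun m => d (n + i + m)) (j - i)).
- exact: fsubset_refl.
- by rewrite subn_gt0.
- by rewrite addn0.
- by rewrite addn0.
- by rewrite addn0.
- move=> m mj; split; first by rewrite addnS s_step.
  by apply: s_alive; lia.
- move=> p pS; rewrite addn0 -addnA subnKC ?(ltnW ij) //.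
  have pN x y : x = y %[mod primes_prod S] -> x = y %[mod p].
    by move=> xy; rewrite -(modn_dvdm x (dvdn_primes_prod pS)) xy modn_dvdm ?dvdn_primes_prod.
  by split; apply/esym/pN.
Qed.

(** While the direction is constant, the new entries form a progression whose difference is the
    unchanged coordinate, and [avoid_primes] finds an uncovered one within a product of [S]
    terms. *)
Lemma direction_change S s d n : prime_fset S -> steps s d ->
  (forall m, unit_gcd S (s m)) ->
  (forall m, n <= m < n + primes_prod S -> covered S (new s m)) ->
  exists2 i, i < primes_prod S & d (n + i) != d (n + i).+1.
Proof.
move=> S_prime s_step s_gcd s_cov; apply: contrapT => no_change.
have d_const i : i <= primes_prod S -> d (n + i) = d n.
  elim: i => [|i IH] i_lt; first by rewrite addn0.
  rewrite addnS -(IH (ltnW i_lt)); apply/eqP; rewrite eq_sym.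
  by apply/negPn/negP => di; apply: no_change; exists i.
have N0 := primes_prod_gt0 S_prime.
have S_all : all prime S by apply/allP => p; exact: S_prime.
have S_gcd p : p \in S -> p %| (s n).1 -> p %| (s n).2 -> False.
  by move=> pS; apply: unit_gcdP (s_gcd n) pS (S_prime _ pS).
case dn: (d n) in d_const.
  have sn i : i <= primes_prod S -> s (n + i) = ((s n).1 + i * (s n).2, (s n).2).
    elim: i => [|i IH] i_le; first by rewrite addn0 mul0n addn0; case: (s n).
    by rewrite addnS s_step d_const ?IH ?(ltnW i_le) //= mulSn addnA addnAC.
  have [|k kN k_ok] := @avoid_primes S (s n).2 ((s n).1 + (s n).2) (fset_uniq S) S_all.
    move=> p pS p2; rewrite dvdn_addl // => p1; exact: (S_gcd p).
  have [|p pS] := s_cov (n + k); first by rewrite leq_addr ltn_add2l.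
  by apply/negP; rewrite /new sn ?(ltnW kN) //= addnAC; exact: k_ok.
have sn i : i <= primes_prod S -> s (n + i) = ((s n).1, (s n).2 + i * (s n).1).
  elim: i => [|i IH] i_le; first by rewrite addn0 mul0n addn0; case: (s n).
  by rewrite addnS s_step d_const ?IH ?(ltnW i_le) //= mulSn addnCA.
have [|k kN k_ok] := @avoid_primes S (s n).1 ((s n).1 + (s n).2) (fset_uniq S) S_all.
  move=> p pS p1; rewrite dvdn_addr // => p2; exact: (S_gcd p).
have [|p pS] := s_cov (n + k); first by rewrite leq_addr ltn_add2l.
by apply/negP; rewrite /new sn ?(ltnW kN) //= addnA; exact: k_ok.
Qed.

(** The two steps around a change of direction replace both coordinates by new entries, which are
    covered. From then on covered new entries keep the pairs alive, long enough for
    [alive_segment]. *)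
Lemma covered_block S s d n : prime_fset S -> steps s d ->
  0 < (s 0).1 -> 0 < (s 0).2 -> (forall m, unit_gcd S (s m)) ->
  (forall m, n <= m < n + (primes_prod S + 2 + primes_prod S * primes_prod S) ->
     covered S (new s m)) ->
  infinite_type S.
Proof.
move=> S_prime s_step x0 y0 s_gcd s_cov.
set N := primes_prod S in s_cov *.
have [|i iN di] := @direction_change S s d n S_prime s_step s_gcd.
  by move=> m m_range; apply: s_cov; rewrite -/N in m_range; lia.
have [xi yi] := steps_pos (n + i).+2 s_step x0 y0.
apply: (alive_segment (n := (n + i).+2) S_prime s_step) => // m.
rewrite -/N in iN * => /andP[im mN].
have [s1 s2] : covered S (s m).1 /\ covered S (s m).2.
  have : forall t, t < N * N -> covered S (s ((n + i).+2 + t)).1 /\ covered S (s ((n + i).+2 + t)).2.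
    elim=> [|t IH] tN.
      have cov0 : covered S (new s (n + i)) by apply: s_cov; lia.
      have cov1 : covered S (new s (n + i).+1) by apply: s_cov; lia.
      move: cov1 cov0 di; rewrite addn0 /new !s_step.
      by case: (d (n + i)); case: (d _) => /=.
    have cov : covered S (new s ((n + i).+2 + t)) by apply: s_cov; lia.
    have [c1 c2] := IH (ltnW tN); rewrite addnS s_step.
    by case: (d _); split.
  by move=> /(_ (m - (n + i).+2)); rewrite subnKC //; apply; lia.
have [p pS p1] := s1; have [p' p'S p'2] := s2; by exists p, p'.
Qed.

Lemma steps_combination s d n t : steps s d ->
  exists al be ga de, [/\ (s (n + t)).1 = al * (s n).1 + be * (s n).2,
    (s (n + t)).2 = ga * (s n).1 + de * (s n).2,
    (0 < al <= 2 ^ t) && (0 < de <= 2 ^ t) & (be <= 2 ^ t) && (ga <= 2 ^ t)].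
Proof.
move=> s_step; elim: t => [|t [al [be [ga [de [e1 e2 bd1 bd2]]]]]].
  by exists 1, 0, 0, 1; rewrite addn0; split; rewrite ?mul1n ?mul0n ?addn0.
rewrite addnS s_step expnS; case: (d _) => /=.
  exists (al + ga), (be + de), ga, de; rewrite e1 e2; split=> //; lia.
exists al, be, (al + ga), (be + de); rewrite e1 e2; split=> //; lia.
Qed.

(** The prime [q] divides one coordinate of [s n.+1], namely [new s n], and not the other. Since
    [new s m] is a combination of the two with positive coefficients at most 2 ^ W, [q] divides the
    coefficient of the other coordinate. *)
Lemma new_repeat_bound s d n m W q : steps s d -> prime q ->
  (q %| (s n.+1).1 -> q %| (s n.+1).2 -> False) -> n < m <= n + W ->
  q %| new s n -> q %| new s m -> q <= 2 ^ W.
Proof.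
move=> s_step q_pr s_gcd /andP[nm mW] qn qm.
have [al [be [ga [de [e1 e2 bd1 bd2]]]]] := steps_combination n.+1 (m - n.+1) s_step.
rewrite subnKC // in e1 e2.
have pow : 2 ^ (m - n.+1) * 2 <= 2 ^ W by rewrite -expnSr leq_exp2l // -subSn // subSS leq_subLR.
case/andP: bd1 => /andP[al0 al_le] /andP[de0 de_le]; case/andP: bd2 => be_le ga_le.
have newE : new s m = (al + ga) * (s n.+1).1 + (be + de) * (s n.+1).2.
  by rewrite /new e1 e2; lia.
move: qm; rewrite newE.
have sn := s_step n; case: (d n) sn => sn qm.
  have q1 : q %| (s n.+1).1 by rewrite sn.
  have {qm} /dvdn_leq q_le : q %| be + de.
    move: qm; rewrite (dvdn_addr _ (dvdn_mull _ q1)) Euclid_dvdM // => /orP[//|q2].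
    by case: s_gcd.
  apply: leq_trans (q_le _) _; first by rewrite addn_gt0 de0 orbT.
  by apply: leq_trans pow; rewrite muln2 -addnn leq_add.
have q2 : q %| (s n.+1).2 by rewrite sn.
have {qm} /dvdn_leq q_le : q %| al + ga.
  move: qm; rewrite (dvdn_addl _ (dvdn_mull _ q2)) Euclid_dvdM // => /orP[//|q1].
  by case: s_gcd.
apply: leq_trans (q_le _) _; first by rewrite addn_gt0 al0.
by apply: leq_trans pow; rewrite muln2 -addnn leq_add.
Qed.

Lemma unit_gcd_sub S Q z : prime_fset S -> (S `<=` Q)%fset -> unit_gcd Q z -> unit_gcd S z.
Proof.
move=> S_prime /fsubsetP SQ; rewrite /unit_gcd => z_gcd; apply/eqP.
rewrite -/(coprime _ _) /primes_prod coprime_sym.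
have: all (coprime^~ (gcdn z.1 z.2)) S.
  apply/allP => p pS; rewrite prime_coprime ?S_prime //; apply/negP => pz.
  apply: (unit_gcdP z_gcd (SQ _ pS) (S_prime _ pS)).
    exact: dvdn_trans pz (dvdn_gcdl _ _).
  exact: dvdn_trans pz (dvdn_gcdr _ _).
by elim: (enum_fset S) => [|p l IH] /=; rewrite ?big_nil ?coprime1n // big_cons coprimeMl => /andP[-> /IH].
Qed.

(* A prime larger than 2 ^ W divides at most one of W consecutive new entries,
   so r large primes leave a long block covered by S alone. *)
Lemma finite_type_extension S r : prime_fset S -> finite_type S ->
  exists B, forall Q, prime_fset Q -> (S `<=` Q)%fset -> #|` Q| <= r ->
    (forall q, q \in Q -> q \notin S -> B < q) -> finite_type Q.
Proof.
move=> S_prime S_fin.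
pose T := primes_prod S + 2 + primes_prod S * primes_prod S.
pose W := r.+1 * T; exists (2 ^ W) => Q Q_prime SQ Q_size Q_large.
apply: contrapT => /infinite_type_walk[s [d [s_walk x0 y0]]].
have s_step : steps s d by move=> n; have [] := s_walk n.
have s_gcd n : unit_gcd Q (s n) by have [] := s_walk n.
have new_cov n : covered Q (new s n).
  have [_ [p [p' [pQ p'Q p1 p'2]]] _] := s_walk n.+1; have [sn _ _] := s_walk n.
  move: p1 p'2; rewrite sn; case: (d n) => /= p1 p'2; first by exists p.
  by exists p'.
(* A block covered by [S] alone would make [S] of infinite type. As [Q] has at most [r] members, two
   of these r + 1 blocks share their large prime. *)
have bad_block (i : 'I_r.+1) : exists nq : nat * nat,
    [/\ i * T <= nq.1 < i.+1 * T, nq.2 \in Q, nq.2 \notin S & nq.2 %| new s nq.1].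
  apply: contrapT => no_bad.
  apply: (covered_block (n := i * T) S_prime s_step x0 y0 _ _ S_fin).
    by move=> m; apply: unit_gcd_sub SQ (s_gcd m).
  move=> m m_range; have [q qQ qm] := new_cov m; exists q => //.
  apply/negPn/negP => qS; apply: no_bad; exists (m, q); split=> //=.
  by rewrite mulSn [T + _]addnC.
have [nq nqP] := choice bad_block.
have nq_inj : injective (fun i => (nq i).2).
  suff lt_inj (i j : 'I_r.+1) : i < j -> (nq i).2 = (nq j).2 -> False.
    move=> i j eq_ij; apply/val_inj/eqP; case: (ltngtP i j) => // [|] lt_ij.
      by case: (lt_inj _ _ lt_ij eq_ij).
    by case: (lt_inj _ _ lt_ij (esym eq_ij)).
  move=> lt_ij eq_q; have [n_range qQ qS qn] := nqP i; have [m_range _ _ qm] := nqP j.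
  have q_pr := Q_prime _ qQ; have := Q_large _ qQ qS; rewrite ltnNge => /negP; apply.
  rewrite -eq_q in qm; apply: (new_repeat_bound s_step q_pr _ _ qn qm).
    exact: unit_gcdP (s_gcd _) qQ q_pr.
  have := ltn_ord j; have : i.+1 * T <= j * T by rewrite leq_mul2r lt_ij orbT.
  have : j.+1 * T <= W by rewrite leq_mul2r ltn_ord orbT.
  by lia.
have nq_uniq : uniq [seq (nq i).2 | i <- enum 'I_r.+1].
  by rewrite map_inj_uniq ?enum_uniq.
have nq_sub : {subset [seq (nq i).2 | i <- enum 'I_r.+1] <= Q}.
  by move=> q /mapP[i _ ->]; have [] := nqP i.
have := uniq_leq_size nq_uniq nq_sub.
by rewrite size_map size_enum_ord ltnNge Q_size.
Qed.

(** If the members of [P] up to [B] form a proper subset [S], then [S] is of finite type. As [P] is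
    not, it has a further member up to the extension bound [c S]; the new bound is a maximum over
    the finitely many possible [S]. *)
Lemma primitive_sets_bounded r k : k <= r -> exists B, forall P,
  primitive_set P -> #|` P| = r -> k <= #|` [fset p in P | p <= B]%fset|.
Proof.
elim: k => [|k IH] kr; first by exists 0.
have [B B_ok] := IH (ltnW kr).
have /choice[c c_ok] : forall S, exists b, prime_fset S -> finite_type S ->
    forall Q, prime_fset Q -> (S `<=` Q)%fset -> #|` Q| <= r ->
    (forall q, q \in Q -> q \notin S -> b < q) -> finite_type Q.
  move=> S; have [[S_prime S_fin]|no_S] := pselect (prime_fset S /\ finite_type S).
    by have [b b_ok] := finite_type_extension r S_prime S_fin; exists b.
  by exists 0 => S_prime S_fin; case: no_S.
pose small := [fset p in iota 0 B.+1]%fset.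
pose B' := maxn B (\max_(S <- fpowerset small) c S); exists B' => P P_prim P_size.
have [P_prime P_inf P_min] := P_prim.
pose S := [fset p in P | p <= B]%fset.
have kS : k <= #|` S| := B_ok P P_prim P_size.
have SP : (S `<=` P)%fset by apply/fsubsetP => p; rewrite !inE => /andP[].
have SS' : (S `<=` [fset p in P | p <= B'])%fset.
  apply/fsubsetP => p; rewrite !inE => /andP[-> pB] /=.
  by rewrite (leq_trans pB) // leq_maxl.
have [k_lt|S_le] := ltnP k #|` S|.
  exact: leq_trans k_lt (fsubset_leq_card SS').
have S_proper : (S `<` P)%fset.
  rewrite fproperEneq SP andbT; apply: contraTneq S_le => ->.
  by rewrite P_size -ltnNge.
have S_prime : prime_fset S by move=> p /(fsubsetP SP)/P_prime.
have S_small : S \in fpowerset small.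
  by rewrite fpowersetE; apply/fsubsetP => p; rewrite !inE mem_iota /=; lia.
have [q [qP qS qc]] : exists q, [/\ q \in P, q \notin S & q <= c S].
  apply: contrapT => no_q; apply: P_inf.
  apply: (c_ok S S_prime (P_min _ S_proper) P P_prime SP); first by rewrite P_size.
  move=> q qP qS; rewrite ltnNge; apply/negP => qc; apply: no_q; by exists q.
have qS' : (q |` S `<=` [fset p in P | p <= B'])%fset.
  rewrite fsubUset SS' andbT fsub1set !inE qP /= (leq_trans qc) //.
  rewrite leq_max; apply/orP; right.
  by rewrite (big_rem S) //= leq_maxl.
by have := fsubset_leq_card qS'; rewrite cardfsU1 qS; lia.
Qed.

Theorem finite_primitive_sets r :
  finite_set [set P : {fset nat} | primitive_set P /\ #|` P| = r].
Proof.
have [B B_ok] := primitive_sets_bounded (leqnn r).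
pose small := [fset p in iota 0 B.+1]%fset.
apply: (@sub_finite_set _ _ [set` fpowerset small]); last exact: finite_fset.
move=> P [P_prim P_size] /=; rewrite fpowersetE.
have: [fset p in P | p <= B]%fset = P.
  apply/eqP; rewrite eqEfcard; apply/andP; split.
    by apply/fsubsetP => p; rewrite !inE => /andP[].
  by rewrite P_size B_ok.
by move=> <-; apply/fsubsetP => p; rewrite !inE mem_iota /=; lia.
Qed.

End Extension.

(** * Two infinite sets of five primes *)

Section Cycles.
Local Open Scope nat_scope.

Definition residues (p : nat) (z : nat * nat) : nat * nat := (z.1 %% p, z.2 %% p).

Definition residue_path (p : nat) (z : nat * nat) (u : seq bool) : seq (nat * nat) :=
  residues p z :: scanl (fun r b => residues p (child b r)) (residues p z) u.

(** The walk is followed modulo each prime separately, which keeps the numbers small. *)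
Definition alive_cycle (l : seq nat) (z : nat * nat) (u : seq bool) : bool :=
  let paths := [seq residue_path p z u | p <- l] in
  [&& 0 < size u, 0 < z.1, 0 < z.2, coprime z.1 z.2,
      all (fun r => nth (1, 1) r (size u) == nth (1, 1) r 0) paths &
      all (fun i => has (fun r => (nth (1, 1) r i).1 == 0) paths &&
                    has (fun r => (nth (1, 1) r i).2 == 0) paths)
          (iota 0 (size u))].

Lemma residues_child p b z : residues p (child b (residues p z)) = residues p (child b z).
Proof. by case: b; rewrite /residues /= !modnDmr ?modn_mod !modnDml. Qed.

Lemma nth_residue_path p z u i : i <= size u ->
  nth (1, 1) (residue_path p z u) i =
  residues p (foldl (fun w b => child b w) z (take i u)).
Proof.
move=> iu; rewrite nth_cons_scanl //; elim: (take i u) z => //= b v IH z.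
by rewrite residues_child IH.
Qed.

Lemma alive_cycle_infinite (l : seq nat) z u (Q : {fset nat}) :
  alive_cycle l z u -> {subset l <= Q} -> infinite_type Q.
Proof.
rewrite /alive_cycle all_map => /and5P[u0 z1 z2 z_coprime /andP[/allP closed /allP u_alive]] lQ.
pose s i := foldl (fun w b => child b w) z (take i u).
have lQ' : ([fset p in l] `<=` Q)%fset by apply/fsubsetP => p; rewrite !inE => /lQ.
apply: (cycle_infinite_type (s := s) (d := nth true u) lQ' u0).
- by rewrite /s take0.
- by rewrite /s take0.
- by rewrite /unit_gcd /s take0 (eqP z_coprime) gcd1n.
- move=> i iu; split; first by rewrite /s (take_nth true iu) foldl_rcons.
  have /u_alive : i \in iota 0 (size u) by rewrite mem_iota.
  rewrite !has_map => /andP[/hasP[p pl /= p1] /hasP[p' p'l /= p'2]].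
  exists p, p'; rewrite !inE; split=> //.
    by move: p1; rewrite nth_residue_path // ltnW.
  by move: p'2; rewrite nth_residue_path // ltnW.
- move=> p; rewrite inE => /closed /=; rewrite !nth_residue_path // => /eqP rE.
  rewrite /s take0; split; [exact: (congr1 fst rE)|exact: (congr1 snd rE)].
Qed.

Lemma infinite_2_3_5_7_19 (Q : {fset nat}) :
  {subset [:: 2; 3; 5; 7; 19] <= Q} -> infinite_type Q.
Proof.
pose u := [:: false; true; false; true; true; false; false].
(* One round of [u] fixes the residues modulo 2 and 3 and multiplies them by 2 modulo 5, by 4 modulo
   7 and by 8 modulo 19. These scalars have orders 4, 3 and 6, hence 12 rounds. *)
apply: (@alive_cycle_infinite _ (55, 19) (flatten (nseq 12 u))).
by vm_compute.
Qed.

Lemma infinite_2_3_5_13_17 (Q : {fset nat}) :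
  {subset [:: 2; 3; 5; 13; 17] <= Q} -> infinite_type Q.
Proof.
pose u := [:: false; true; false; true; true; false; true; true; false;
              true; false; true; false; false; true; false; false; true].
(* the period is repeated until the residues, and not only their ratio, return *)
apply: (@alive_cycle_infinite _ (28, 115) (flatten (nseq 6 u))).
by vm_compute.
Qed.

End Cycles.

(** * Density *)

From mathcomp Require Import ring lra.
Local Delimit Scope Z_scope with BZ.
Local Open Scope ring_scope.

(** * Counting integers by their square divisors *)

Section Counting.
Variable R : realType.
Implicit Types (f g h : pred nat) (l acc : seq nat) (N M j q : nat).

Definition cnt f N : nat := count f (iota 1 N).

Definition sq M q : bool := prime q && (q ^ 2 %| M)%N.

Lemma cntS f N : cnt f N.+1 = (cnt f N + f N.+1)%N.
Proof. by rewrite /cnt -[N.+1 in LHS]addn1 iotaD count_cat /= addn0 add1n. Qed.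

Lemma sub_cnt f g N : (forall M, (0 < M)%N -> f M -> g M) -> (cnt f N <= cnt g N)%N.
Proof.
move=> fg; elim: N => [|N IH] //; rewrite !cntS leq_add //.
by case fN: (f N.+1) => //; rewrite fg.
Qed.

Lemma cnt_or f g h N : (forall M, (0 < M)%N -> f M -> g M || h M) ->
  (cnt f N <= cnt g N + cnt h N)%N.
Proof.
move=> fgh; elim: N => [|N IH] //; rewrite !cntS addnACA leq_add //.
by case fN: (f N.+1) => //; have := fgh N.+1 isT fN; case: (g _) (h _) => -[].
Qed.

Lemma cnt0 f N : (forall M, (0 < M)%N -> ~~ f M) -> cnt f N = 0%N.
Proof. by move=> f0; elim: N => // N IH; rewrite cntS IH (negbTE (f0 _ _)). Qed.

Lemma cnt_dvd D N : (0 < D)%N -> cnt (dvdn D) N = (N %/ D)%N.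
Proof. by move=> D0; elim: N => [|N IH]; rewrite ?div0n // cntS IH divnS // addnC. Qed.

Lemma cnt_has (T : Type) (F : T -> pred nat) (s : seq T) N :
  (cnt (fun M => has (F^~ M) s) N <= \sum_(t <- s) cnt (F t) N)%N.
Proof.
elim: s => [|t s IH]; first by rewrite big_nil leqn0; apply/eqP/cnt0.
rewrite big_cons; apply: leq_trans (leq_add (leqnn _) IH).
by apply: cnt_or => M _ /=.
Qed.

Definition sqprod acc : nat := (\prod_(q <- acc) q ^ 2)%N.

Lemma sqprod_dvd acc M : uniq acc -> all (sq M) acc -> (sqprod acc %| M)%N.
Proof.
move=> + /allP; rewrite /sqprod; elim: acc => [|q acc IH]; first by rewrite big_nil dvd1n.
rewrite cons_uniq big_cons => /andP[q_acc acc_uniq] acc_sq.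
have /andP[q_pr qM] := acc_sq q (mem_head _ _).
rewrite Gauss_dvd ?qM ?IH // => [q' q'acc|]; first by rewrite acc_sq // inE q'acc orbT.
rewrite coprimeXl // coprime_sym big_seq; apply: (big_ind (coprime^~ q)).
- exact: coprime1n.
- by move=> x y; rewrite coprimeMl => -> ->.
move=> q' q'acc; have /andP[q'_pr _] := acc_sq q' ltac:(by rewrite inE q'acc orbT).
rewrite coprimeXl // prime_coprime // dvdn_prime2 //.
by apply: contraNneq q_acc => <-.
Qed.

Lemma sqprod_gt0 acc : all prime acc -> (0 < sqprod acc)%N.
Proof.
by move=> /allP acc_pr; rewrite /sqprod big_seq prodn_cond_gt0 // => q /acc_pr/prime_gt0; rewrite expn_gt0 => ->.
Qed.

Definition wt acc : R := \prod_(q <- acc) q%:R ^- 2.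

Lemma wt_ge0 acc : 0 <= wt acc.
Proof. by apply: prodr_ge0 => q _; rewrite invr_ge0 exprn_ge0. Qed.

Lemma wtE acc : wt acc = (sqprod acc)%:R^-1.
Proof.
rewrite /wt /sqprod; elim: acc => [|q acc IH]; first by rewrite !big_nil invr1.
by rewrite !big_cons IH natrM natrX [RHS]invfM.
Qed.

Lemma divn_le N D : (0 < D)%N -> (N %/ D)%:R <= N%:R / D%:R :> R.
Proof.
move=> D0; rewrite ler_pdivlMr ?ltr0n // -natrM ler_nat.
exact: leq_divM.
Qed.

Lemma divn_ge N D : (0 < D)%N -> N%:R / D%:R - 1 <= (N %/ D)%:R :> R.
Proof.
move=> D0; rewrite lerBlDr ler_pdivrMr ?ltr0n // -[1]/(1%:R) -natrD -natrM ler_nat.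
by rewrite addn1 ltnW // ltn_ceil.
Qed.

Lemma cnt_all acc N : uniq acc ->
  (cnt (fun M => all (sq M) acc) N)%:R <= N%:R * wt acc.
Proof.
move=> acc_uniq; have [acc_pr|acc_npr] := boolP (all prime acc); last first.
  rewrite cnt0 ?mulr_ge0 ?wt_ge0 // => M _; apply: contraNN acc_npr.
  by apply: sub_all => q /andP[].
rewrite wtE; apply: le_trans (divn_le _ (sqprod_gt0 acc_pr)).
rewrite ler_nat -cnt_dvd ?sqprod_gt0 //; apply: sub_cnt => M _.
exact: sqprod_dvd.
Qed.

(** The elementary symmetric sum of degree [j] in the numbers 1 / q^2. *)
Fixpoint esym l j : R :=
  match j, l with
  | 0%N, _ => 1
  | _.+1, [::] => 0
  | j'.+1, q :: l' => q%:R ^- 2 * esym l' j' + esym l' j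
  end.

Lemma esym0 l : esym l 0 = 1. Proof. by case: l. Qed.

(** A union bound over the choices of [j] primes from [l]: the head [q] either joins [acc] or is
    left out. *)
Lemma cnt_esym acc l j N : uniq (acc ++ l) ->
  (cnt (fun M => all (sq M) acc && (j <= count (sq M) l)%N) N)%:R <=
  N%:R * (wt acc * esym l j).
Proof.
elim: l acc j => [|q l IH] acc j acc_uniq.
  case: j => [|j]; last by rewrite cnt0 ?mulr0 // => M _; rewrite andbF.
  rewrite mulr1; rewrite cats0 in acc_uniq; apply: le_trans (cnt_all N acc_uniq).
  by rewrite ler_nat; apply: sub_cnt => M _ /andP[].
case: j => [|j].
  rewrite mulr1; have acc_uniq' : uniq acc by move: acc_uniq; rewrite cat_uniq => /andP[].
  apply: le_trans (cnt_all N acc_uniq').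
  by rewrite ler_nat; apply: sub_cnt => M _ /andP[].
have uniq1 : uniq ((q :: acc) ++ l).
  by rewrite (perm_uniq (permEl (perm_catCA [:: q] acc l))).
have uniq2 : uniq (acc ++ l) by move: uniq1 => /andP[].
have -> : wt acc * esym (q :: l) j.+1 =
    wt (q :: acc) * esym l j + wt acc * esym l j.+1.
  by rewrite /wt big_cons /= mulrDr mulrCA mulrA.
rewrite mulrDr.
apply: le_trans (lerD (IH _ _ uniq1) (IH _ _ uniq2)).
rewrite -natrD ler_nat; apply: cnt_or => M _ /= /andP[-> j_le].
case: (sq M q) j_le => /=; first by rewrite add1n ltnS => ->.
by rewrite add0n => ->.
Qed.

(** The induction rests on 1/m^2 + 1/m <= 1/(m - 1), which in degree 1 is the telescoping bound for
    the sum of 1/k^2. *)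
Lemma esym_iota m n j : (1 < m)%N -> esym (iota m n) j <= (m.-1%:R ^-1) ^+ j.
Proof.
move=> m1; elim: n m m1 j => [|n IH] m m1 [|j]; rewrite ?esym0 ?expr0 ?lexx //.
  by apply: exprn_ge0; rewrite invr_ge0.
rewrite -[esym _ _]/(m%:R ^- 2 * esym (iota m.+1 n) j + esym (iota m.+1 n) j.+1).
have m0 : (0 : R) < m.-1%:R by rewrite ltr0n; lia.
have mE : (m%:R : R) = m.-1%:R + 1 by rewrite natr1 prednK // ltnW.
set u := m.-1%:R in m0 mE *.
have IHm := IH m.+1 (leqW m1); rewrite /= mE in IHm.
have v0 : 0 < (u + 1)^-1 by rewrite invr_gt0 addr_gt0.
set v := (u + 1)^-1 in v0 IHm.
have vj : 0 <= v ^+ j by rewrite exprn_ge0 // ltW.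
have uv : v ^+ 2 + v <= u^-1.
  rewrite /v -subr_ge0.
  have -> : u^-1 - ((u + 1)^-1 ^+ 2 + (u + 1)^-1) = u^-1 * ((u + 1)^-1 ^+ 2).
    by field; rewrite !gt_eqF // addr_gt0.
  by rewrite mulr_ge0 // ?exprn_ge0 // ltW // invr_gt0 // addr_gt0.
have vu : v <= u^-1 by apply: le_trans uv; rewrite lerDr exprn_ge0 // ltW.
rewrite mE -exprVn -/v.
apply: (@le_trans _ _ (v ^+ 2 * v ^+ j + v ^+ j.+1)).
  by rewrite lerD // ler_wpM2l // exprn_ge0 // ltW.
rewrite [v ^+ j.+1]exprS -mulrDl [u^-1 ^+ j.+1]exprS; apply: ler_pM => //.
  by rewrite addr_ge0 ?exprn_ge0 // ltW.
by apply: lerXn2r => //; rewrite nnegrE ?ltW // invr_gt0.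
Qed.

End Counting.

(** * Integer arithmetic for the density bounds *)

Section FixedPoint.
Local Open Scope Z_scope.

(** Densities are integers over [scale]; every division rounds up, so all results are upper
    bounds. *)
Definition scale : Z := 10 ^ 24.

Definition ceil_div (x d : Z) : Z := - (- x / d).

Lemma ceil_div_ge x d : 0 < d -> x <= ceil_div x d * d.
Proof. by move=> d0; have := Z.mul_div_le (- x) d d0; rewrite /ceil_div; lia. Qed.

Lemma ceil_div0 d : ceil_div 0 d = 0.
Proof. by rewrite /ceil_div; case: d. Qed.

(** Adding a number with square [d] to the list adds to each bound the one of the previous degree
    divided by [d]; [p] carries that previous bound. *)
Fixpoint esym_step (d p : Z) (E : seq Z) : seq Z :=
  if E is x :: E' then (x + ceil_div p d) :: esym_step d x E' else [::].

Definition esym_bounds (l E : seq Z) : seq Z :=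
  foldr (fun q => esym_step (q * q) 0) E l.

Definition known_nat : seq (seq nat) := map (map Z.to_nat) known_sets.

(* j primes remain to be chosen from l and from the range bounded by E; the
   chosen ones, acc, have squares of product D. *)
Fixpoint excluding_bound (E : seq Z) (acc l : seq nat) (D : Z) (j : nat) : Z :=
  if has (all (fun p => p \in acc)) known_nat then 0
  else if j is j'.+1 then
    if l is q :: l' then
      let q' := Z.of_nat q in
      excluding_bound E (q :: acc) l' (D * (q' * q')) j' +
      excluding_bound E acc l' D j
    else ceil_div (nth 0 E j) D
  else ceil_div scale D.

Fixpoint zrange (a : Z) (n : nat) : seq Z :=
  if n is n'.+1 then a :: zrange (a + 1) n' else [::].

(** Exact below 59^2 = 3481; composite survivors from there on only enlarge the bound. *)
Definition sieve (n : Z) : bool :=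
  all (fun p => (n <=? p) || ~~ (n mod p =? 0))
    [:: 2; 3; 5; 7; 11; 13; 17; 19; 23; 29; 31; 37; 41; 43; 47; 53].

Definition small_primes : seq nat := [:: 2; 3; 5; 7; 11; 13; 17; 19; 23; 29; 31]%N.

(* A superset of the primes between 32 and 6000. *)
Definition mid_range : seq Z := [seq n <- zrange 32 (Z.to_nat 5969) | sieve n].

(** Degrees 0 to 7 of the bound [esym_iota] for the integers from 6001 on. *)
Definition tail_bounds : seq Z :=
  [seq ceil_div scale (6000 ^ Z.of_nat j) | j <- iota 0 8].

Definition seven_bound : Z :=
  excluding_bound (esym_bounds mid_range tail_bounds) [::] small_primes 1 7.

(* If q completes K to one of the two 5-sets, then only the M that are not
   divisible by q ^ 2 have to be counted for K. *)
Definition completing (K : seq Z) : seq Z :=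
  [seq q <- [:: 7; 13; 17; 19]
     | (q \notin K) && has (all (fun p => p \in q :: K)) (take 2 known_sets)].

Definition Zsqprod (K : seq Z) : Z := foldr (fun q D => q * q * D) 1 K.

Definition six_bound (K : seq Z) : Z :=
  if completing K is q :: _ then
    ceil_div (scale * (q * q - 1)) (Zsqprod K * (q * q))
  else ceil_div scale (Zsqprod K).

(* Inclusion-exclusion for (2*3*5*7*19)^2 and (2*3*5*13*17)^2: over the common
   denominator 881790 ^ 2 the numerators are (13*17)^2, (7*19)^2 and 1. *)
Definition five_bound : Z := ceil_div (scale * (221 ^ 2 + 133 ^ 2 - 1)) (881790 ^ 2).

Definition total_bound : Z :=
  five_bound + foldr (fun K => Z.add (six_bound K)) 0 (drop 2 known_sets)
  + seven_bound.

Lemma total_bound_le : total_bound * 10 ^ 11 <= 8746 * scale.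
Proof. by apply/Z.leb_spec0; vm_compute. Qed.

Lemma zrange_iota a n : 0 <= a ->
  map Z.to_nat [seq k <- zrange a n | sieve k] =
  [seq k <- iota (Z.to_nat a) n | sieve (Z.of_nat k)].
Proof.
elim: n a => //= n IH a a0; rewrite Z2Nat.id //.
have := IH (a + 1) ltac:(lia).
by rewrite (_ : Z.to_nat (a + 1) = (Z.to_nat a).+1); [move=> <-; case: ifP|lia].
Qed.

End FixedPoint.

(* locked: unfolding it at [scale] would expand a unary integer *)
HB.lock Definition zr (R : realType) (z : Z) : R := (int_of_Z z)%:~R.

(** * The bound for integers with seven square prime divisors *)

Section UpperBound.
Variable R : realType.
Implicit Types (acc l : seq nat) (K : seq Z) (N M j q : nat).

Local Notation zr := (zr R).

Lemma zrD (a b : Z) : zr (a + b)%BZ = zr a + zr b.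
Proof. by rewrite !zr.unlock (_ : int_of_Z _ = int_of_Z a + int_of_Z b) ?intrD; last lia. Qed.
Lemma zrM (a b : Z) : zr (a * b)%BZ = zr a * zr b.
Proof. by rewrite !zr.unlock (_ : int_of_Z _ = int_of_Z a * int_of_Z b) ?intrM; last lia. Qed.
Lemma zr_nat n : zr (Z.of_nat n) = n%:R.
Proof. by rewrite zr.unlock (_ : int_of_Z _ = n); last lia. Qed.
Lemma ler_zr (a b : Z) : (a <= b)%BZ -> zr a <= zr b.
Proof. by move=> ab; rewrite zr.unlock ler_int; lia. Qed.
Lemma zr_gt0 (a : Z) : (0 < a)%BZ -> 0 < zr a.
Proof. by move=> a0; rewrite zr.unlock (ltr_int R 0); lia. Qed.
Lemma zrX (a : Z) n : zr (a ^ Z.of_nat n)%BZ = zr a ^+ n.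
Proof.
elim: n => [|n IH]; first by rewrite expr0 -[RHS]/(1%:R) -zr_nat.
rewrite Nat2Z.inj_succ Z.pow_succ_r; last by lia.
by rewrite zrM IH exprS.
Qed.

Definition fixed (z : Z) : R := zr z / zr scale.

Lemma scale_gt0 : 0 < zr scale. Proof. exact: zr_gt0. Qed.

Lemma fixedD (a b : Z) : fixed (a + b)%BZ = fixed a + fixed b.
Proof. by rewrite /fixed zrD mulrDl. Qed.

Lemma fixed_scale : fixed scale = 1.
Proof. by rewrite /fixed divff // gt_eqF // scale_gt0. Qed.

Lemma fixed0 : fixed 0 = 0.
Proof. by rewrite /fixed -[0%BZ]/(Z.of_nat 0) zr_nat mul0r. Qed.

Lemma fixed_ceil_div x d : (0 < d)%BZ -> fixed x / zr d <= fixed (ceil_div x d).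
Proof.
move=> d0; rewrite ler_pdivrMr ?zr_gt0 // /fixed mulrAC -zrM.
by rewrite ler_pM2r ?invr_gt0 ?scale_gt0 // ler_zr //; exact: ceil_div_ge.
Qed.

Definition bounded_by l (E : seq Z) : Prop :=
  forall j, (j < size E)%N -> esym R l j <= fixed (nth 0%BZ E j).

Lemma size_esym_step d p E : size (esym_step d p E) = size E.
Proof. by elim: E p => //= x E IH p; rewrite IH. Qed.

Lemma nth_esym_step d p E j : (j < size E)%N ->
  nth 0%BZ (esym_step d p E) j =
  (nth 0%BZ E j + ceil_div (nth 0%BZ (p :: E) j) d)%BZ.
Proof. by elim: E p j => [//|x E IH] p [|j] //= jE; rewrite IH. Qed.

Lemma bounded_by_cons (q : Z) l (E : seq Z) : (0 < q)%BZ -> bounded_by l E ->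
  bounded_by (Z.to_nat q :: l) (esym_step (q * q) 0 E).
Proof.
move=> q0 lE [|j]; rewrite size_esym_step => jE; rewrite nth_esym_step // fixedD /=.
  by rewrite ceil_div0 fixed0 addr0 -(esym0 R l); exact: lE.
rewrite addrC lerD ?lE //; apply: le_trans (fixed_ceil_div _ _); last by nia.
have qE : (Z.to_nat q)%:R = zr q by rewrite -zr_nat Z2Nat.id //; lia.
rewrite mulrC qE zrM -expr2 ler_pM2r ?invr_gt0 ?exprn_gt0 ?zr_gt0 //.
by apply: lE; exact: ltnW.
Qed.

Lemma bounded_by_esym_bounds (s E : seq Z) l : all (Z.ltb 0) s -> bounded_by l E ->
  bounded_by (map Z.to_nat s ++ l) (esym_bounds s E) /\
  size (esym_bounds s E) = size E.
Proof.
elim: s => //= q s IH /andP[/Z.ltb_spec0 q0 s0] lE.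
have [IH1 IH2] := IH s0 lE.
by split; [exact: bounded_by_cons|rewrite size_esym_step].
Qed.

Lemma tail_bounded N : bounded_by (iota (Z.to_nat 6001) N) tail_bounds.
Proof.
move=> j; rewrite size_map size_iota => j8.
rewrite (nth_map 0%N) ?size_iota // nth_iota // add0n.
apply: le_trans (fixed_ceil_div _ _); last by apply: Z.pow_pos_nonneg; lia.
rewrite fixed_scale div1r zrX -exprVn; apply: le_trans (esym_iota _ _ _ _) _; first by lia.
by rewrite (_ : (Z.to_nat 6001).-1 = Z.to_nat 6000) -?zr_nat ?Z2Nat.id //; lia.
Qed.

Definition unknown M : bool := ~~ has (all (sq M)) known_nat.

(** The union bound of [cnt_esym], except that a selection containing a listed set contributes
    nothing, since its [M] are not [unknown]. Once [l] is used up, [E] bounds the remaining choices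
    from [rest]. *)
Lemma cnt_excluding_bound (E : seq Z) rest acc l (D : Z) j N :
  bounded_by rest E -> (j < size E)%N -> uniq (acc ++ l ++ rest) ->
  all (leq 1) l -> (0 < D)%BZ -> wt R acc = (zr D)^-1 ->
  (cnt (fun M => [&& all (sq M) acc, j <= count (sq M) (l ++ rest) & unknown M]%N) N)%:R
    <= N%:R * fixed (excluding_bound E acc l D j).
Proof.
move=> restE.
have known_case (acc' : seq nat) m l' : has (all (fun p => p \in acc')) known_nat ->
    (cnt (fun M => [&& all (sq M) acc', m <= count (sq M) l' & unknown M]%N) N) = 0%N.
  move=> /hasP[K K_known /allP K_acc]; apply: cnt0 => M _.
  apply/and3P => -[/allP acc_sq _ /hasP[]]; exists K => //.
  by apply/allP => p /K_acc/acc_sq.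
have zero_case acc' l' D' : uniq (acc' ++ l') -> (0 < D')%BZ -> wt R acc' = (zr D')^-1 ->
    (cnt (fun M => [&& all (sq M) acc', 0 <= count (sq M) l' & unknown M]%N) N)%:R
    <= N%:R * fixed (ceil_div scale D').
  rewrite cat_uniq => /andP[acc_uniq _] D0 accD.
  apply: (@le_trans _ _ (N%:R * wt R acc')).
    apply: le_trans (cnt_all R N acc_uniq).
    by rewrite ler_nat; apply: sub_cnt => M _ /and3P[].
  by rewrite ler_wpM2l // accD -[(zr _)^-1]mul1r -fixed_scale fixed_ceil_div.
have known0 acc' l' D' i : has (all (fun p => p \in acc')) known_nat ->
    excluding_bound E acc' l' D' i = 0%BZ by case: l' i => [|? ?] [|?] /= ->.
elim: l acc D j => [|q l IH] acc D [|j] jE acc_uniq l_pos D0 accD;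
  (have [known|/negbTE unk] := boolP (has (all (fun p => p \in acc)) known_nat);
   first by rewrite known0 // known_case // fixed0 mulr0); move: unk => /= ->.
- exact: (zero_case acc rest).
- apply: (@le_trans _ _ (N%:R * (wt R acc * esym R rest j.+1))).
    apply: le_trans (cnt_esym _ _ _ acc_uniq).
    by rewrite ler_nat; apply: sub_cnt => M _ /and3P[-> ->].
  rewrite ler_wpM2l // accD mulrC; apply: le_trans (fixed_ceil_div _ D0).
  by rewrite ler_pM2r ?invr_gt0 ?zr_gt0 // restE.
- exact: (zero_case _ (q :: l ++ rest)).
have uniq1 : uniq ((q :: acc) ++ l ++ rest).
  by rewrite (perm_uniq (permEl (perm_catCA [:: q] acc (l ++ rest)))).
have uniq2 : uniq (acc ++ l ++ rest) by move: uniq1 => /andP[].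
move: l_pos => /= /andP[q0 l_pos].
rewrite fixedD mulrDr.
have qD : wt R (q :: acc) = (zr (D * (Z.of_nat q * Z.of_nat q)))^-1.
  by rewrite /wt big_cons -/(wt R acc) accD !zrM zr_nat -expr2 [RHS]invfM mulrC.
have Dq : (0 < D * (Z.of_nat q * Z.of_nat q))%BZ.
  by apply: Z.mul_pos_pos => //; apply: Z.mul_pos_pos; lia.
have IH1 := IH (q :: acc) _ _ (ltnW jE) uniq1 l_pos Dq qD.
have IH2 := IH acc D _ jE uniq2 l_pos D0 accD.
apply: le_trans (lerD IH1 IH2); rewrite -natrD ler_nat; apply: cnt_or => M _.
rewrite /= => /and3P[-> j_le ->]; rewrite !andbT.
by case: (sq M q) j_le => /=; rewrite ?add1n ?ltnS ?add0n => ->.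
Qed.

Definition mid_primes : seq nat := [seq k <- iota 32 (Z.to_nat 5969) | sieve (Z.of_nat k)].

(** It contains all primes up to [N]. Its composite members are never counted, because [sq] tests
    primality. *)
Definition prime_cover N : seq nat :=
  small_primes ++ mid_primes ++ iota (Z.to_nat 6001) N.

Lemma mid_primesE : mid_primes = map Z.to_nat mid_range.
Proof. by rewrite /mid_range zrange_iota. Qed.

Lemma prime_cover_uniq N : uniq (prime_cover N).
Proof.
rewrite /prime_cover /mid_primes; have : Z.to_nat 6001 = (32 + Z.to_nat 5969)%N by lia.
move: (Z.to_nat 5969) (Z.to_nat 6001) => n _ ->.
rewrite cat_uniq cat_uniq filter_uniq ?iota_uniq //= andbT.
apply/andP; split; apply/hasPn => p.
  rewrite mem_cat mem_filter !mem_iota => p_ge; apply/negP => p_small.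
  have : (p <= 31)%N by move: p_small; rewrite !inE; do 10?case/predU1P => [->//|]; move/eqP->.
  by move: p_ge; rewrite leqNgt => /orP[/andP[_ /andP[+ _]]|/andP[+ _]]; lia.
by rewrite mem_iota mem_filter mem_iota => p_ge; apply/negP => /andP[_]; lia.
Qed.

Lemma prime_cover_mem N p : prime p -> (p <= N)%N -> p \in prime_cover N.
Proof.
move=> p_pr pN; rewrite /prime_cover !mem_cat.
have [p_small|p_big] := leqP p 31.
  have chk : all (fun p => prime p ==> (p \in small_primes)) (iota 0 32) by [].
  have p_iota : p \in iota 0 32 by rewrite mem_iota.
  by have := allP chk p p_iota; rewrite p_pr => /= ->.
apply/orP; right; have [p_mid|p_tail] := leqP p (Z.to_nat 6000); last first.
  apply/orP; right; rewrite mem_iota; lia.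
apply/orP; left; rewrite mem_filter mem_iota; apply/andP; split; last by lia.
apply/allP => s s_in; have [s_ge|s_lt] := Z.leb_spec (Z.of_nat p) s; first by [].
have s2 : (1 < s)%BZ by apply/Z.ltb_spec0; move: s s_in {s_lt}; exact/allP.
apply/negP => /Z.eqb_spec s_p.
have sp : (Z.to_nat s %| p)%N.
  apply/dvdnP; exists (Z.to_nat (Z.of_nat p / s)).
  by have := Z.div_mod (Z.of_nat p) s ltac:(lia); rewrite s_p; nia.
by have [_ /(_ _ sp)/orP[]/eqP] := primeP p_pr; lia.
Qed.

Lemma mid_range_pos : all (Z.ltb 0) mid_range.
Proof.
have in_range n a z : (0 < a)%BZ -> z \in zrange a n -> (0 < z)%BZ.
  by elim: n a => //= n IH a a0; rewrite inE => /predU1P[->//|/IH]; apply; lia.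
apply/allP => z; rewrite mem_filter => /andP[_ z_in].
by apply/Z.ltb_spec0; apply: in_range z_in; lia.
Qed.

Lemma size_tail_bounds : size tail_bounds = 8%N.
Proof. by []. Qed.

Lemma mid_bounded N :
  bounded_by (mid_primes ++ iota (Z.to_nat 6001) N) (esym_bounds mid_range tail_bounds) /\
  size (esym_bounds mid_range tail_bounds) = 8%N.
Proof.
rewrite mid_primesE.
have [mid_b size_b] := bounded_by_esym_bounds mid_range_pos (@tail_bounded N).
(* [exact:] would evaluate the bounds *)
refine (conj mid_b (etrans size_b size_tail_bounds)).
Qed.

Lemma cnt_seven N :
  (cnt (fun M => (7 <= count (sq M) (prime_cover N))%N && unknown M) N)%:R
  <= N%:R * fixed seven_bound.
Proof.
have [mid_b size_b] := mid_bounded N.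
have size7 : (7 < size (esym_bounds mid_range tail_bounds))%N by rewrite size_b.
have wt1 : wt R [::] = (zr 1)^-1.
  by rewrite /wt big_nil -[1%BZ]/(Z.of_nat 1) zr_nat invr1.
apply: le_trans (@cnt_excluding_bound _ _ [::] small_primes 1 7 N mid_b size7
  (prime_cover_uniq N) isT Z.lt_0_1 wt1).
rewrite ler_nat; apply: sub_cnt => M _ j_unk.
by rewrite -[all _ _]/true andTb -/(prime_cover N).
Qed.

End UpperBound.

(** * Counts for the listed 5-sets and 6-sets *)

Section Density.
Variable R : realType.
Implicit Types (f g : pred nat) (acc : seq nat) (K : seq Z) (N M p q : nat).
Local Notation zr := (zr R).
Local Notation fixed := (fixed R).

Lemma cnt_split f g N :
  cnt f N = (cnt (fun M => f M && g M) N + cnt (fun M => f M && ~~ g M) N)%N.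
Proof.
elim: N => [|N IH] //; rewrite !cntS IH addnACA; congr addn.
by case: (f _) (g _) => -[].
Qed.

Lemma cnt_cup f g N :
  (cnt (fun M => f M || g M) N + cnt (fun M => f M && g M) N = cnt f N + cnt g N)%N.
Proof. exact: count_predUI. Qed.

Lemma cnt_all_prime acc N : uniq acc -> all prime acc ->
  cnt (fun M => all (sq M) acc) N = (N %/ sqprod acc)%N.
Proof.
move=> acc_uniq acc_pr; rewrite -(cnt_dvd _ (sqprod_gt0 acc_pr)).
apply: eq_in_count => M _; apply/idP/idP; first exact: sqprod_dvd.
move=> accM; apply/allP => q q_acc; rewrite /sq (allP acc_pr _ q_acc).
by apply: dvdn_trans accM; rewrite /sqprod (big_rem q) //= dvdn_mulr.
Qed.

Lemma cnt_all_ge acc N : uniq acc -> all prime acc ->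
  N%:R * wt R acc - 1 <= (cnt (fun M => all (sq M) acc) N)%:R.
Proof.
move=> acc_uniq acc_pr; rewrite cnt_all_prime // wtE divn_ge //.
exact: sqprod_gt0.
Qed.

Lemma known_sets_prime K : K \in known_sets ->
  [/\ uniq (map Z.to_nat K), all prime (map Z.to_nat K) & all (Z.ltb 0) K].
Proof.
have : all (fun K => [&& uniq (map Z.to_nat K), all prime (map Z.to_nat K) &
  all (Z.ltb 0) K]) known_sets by vm_compute.
by move=> /allP/[apply]/and3P.
Qed.

Lemma wt_Zsqprod K : all (Z.ltb 0) K ->
  (0 < Zsqprod K)%BZ /\ wt R (map Z.to_nat K) = (zr (Zsqprod K))^-1.
Proof.
elim: K => [_|q K IH] /=; first by rewrite /wt big_nil -[1%BZ]/(Z.of_nat 1) zr_nat invr1.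
move=> /andP[/Z.ltb_spec0 q0 /IH[K0 KE]]; split; first by nia.
rewrite /wt big_cons -/(wt R _) KE !zrM [RHS]invfM -expr2 -zr_nat Z2Nat.id //; lia.
Qed.

Lemma fixed_scaleM (x : Z) : fixed (scale * x) = zr x.
Proof. by rewrite /fixed zrM mulrAC divff ?mul1r // gt_eqF // scale_gt0. Qed.

Definition six_event K M : bool :=
  all (sq M) (map Z.to_nat K) &&
  (if completing K is q :: _ then ~~ sq M (Z.to_nat q) else true).

Lemma completingP K (q : Z) s : completing K = q :: s ->
  [/\ q \in [:: 7; 13; 17; 19]%BZ, q \notin K &
      exists2 L, L \in take 2 known_sets & {subset L <= q :: K}].
Proof.
move=> KE; have : q \in completing K by rewrite KE mem_head.
rewrite mem_filter => /andP[/andP[qK /hasP[L L_known /allP LK]] q_in].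
by split=> //; exists L.
Qed.

(** With a completing prime, the count for [K] with that prime added is subtracted from the count
    for [K]. The latter has an upper bound without error, the former a lower bound up to 1. *)
Lemma cnt_six K N : K \in known_sets ->
  (cnt (six_event K) N)%:R <= N%:R * fixed (six_bound K) + 1.
Proof.
move=> /known_sets_prime[K_uniq K_pr K_pos].
have [D0 KE] := wt_Zsqprod K_pos; rewrite /six_event /six_bound.
case KqE: (completing K) => [|q s].
  apply: (@le_trans _ _ (N%:R * wt R (map Z.to_nat K))).
    apply: le_trans (cnt_all R N K_uniq).
    by rewrite ler_nat; apply: sub_cnt => M _ /andP[].
  apply: (@le_trans _ _ (N%:R * fixed (ceil_div scale (Zsqprod K)))); last by rewrite lerDl.
  by rewrite ler_wpM2l // KE -[(zr _)^-1]mul1r -fixed_scale fixed_ceil_div.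
have [q_in qK _] := completingP KqE.
have /andP[q_pr /Z.ltb_spec0 q0] : prime (Z.to_nat q) && (0 <? q)%BZ.
  by move: q q_in {KqE qK}; exact/allP.
have q_uniq : uniq (Z.to_nat q :: map Z.to_nat K).
  rewrite /= K_uniq andbT; apply: contraNN qK => /mapP[q' q'K qE].
  suff -> : q = q' by [].
  by have /Z.ltb_spec0 := allP K_pos _ q'K; lia.
have q_all : all prime (Z.to_nat q :: map Z.to_nat K) by rewrite /= q_pr.
set f := fun M => all (sq M) (map Z.to_nat K).
have split_q := cnt_split f (sq^~ (Z.to_nat q)) N.
have cnt_q : cnt (fun M => f M && sq M (Z.to_nat q)) N =
             cnt (fun M => all (sq M) (Z.to_nat q :: map Z.to_nat K)) N.
  by apply: eq_in_count => M _; rewrite /= andbC.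
have f_le : (cnt f N)%:R <= N%:R * wt R (map Z.to_nat K) := cnt_all R N K_uniq.
have q_ge := cnt_all_ge N q_uniq q_all.
rewrite -cnt_q in q_ge; rewrite split_q natrD in f_le.
have {q_ge f_le} : (cnt (fun M => f M && ~~ sq M (Z.to_nat q)) N)%:R <=
   N%:R * (wt R (map Z.to_nat K) - wt R (Z.to_nat q :: map Z.to_nat K)) + 1.
  by rewrite mulrBr; move: f_le q_ge; lra.
move=> /le_trans; apply; rewrite lerD2r ler_wpM2l //.
have qq0 : (0 < Zsqprod K * (q * q))%BZ by nia.
apply: le_trans (fixed_ceil_div R _ qq0).
have -> : wt R (Z.to_nat q :: map Z.to_nat K) = (zr (Zsqprod K * (q * q)))^-1.
  rewrite /wt big_cons -/(wt R _) KE !zrM [RHS]invfM mulrC -expr2 -zr_nat Z2Nat.id //; lia.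
rewrite KE fixed_scaleM.
have qq1 : zr (q * q) = zr (q * q - 1) + 1.
  by rewrite -[1]/(1%:R) -zr_nat -zrD; congr zr; lia.
have Dn0 : zr (Zsqprod K) != 0 by rewrite gt_eqF // zr_gt0.
have qqn0 : zr (q * q) != 0 by rewrite gt_eqF // zr_gt0 //; nia.
rewrite zrM; rewrite qq1 in qqn0 *.
by rewrite le_eqVlt; apply/orP; left; apply/eqP; field; rewrite qqn0.
Qed.

Definition five_event M : bool :=
  has (fun K => all (sq M) (map Z.to_nat K)) (take 2 known_sets).

Definition beta5 : R := zr (221 ^ 2 + 133 ^ 2 - 1) / zr (881790 ^ 2).

(** Inclusion-exclusion, with [U] the union of the two sets. Each lower estimate of a count loses 1:
    two occur on the left and one on the right. *)
Lemma cnt_five N :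
  N%:R * beta5 - 2 <= (cnt five_event N)%:R <= N%:R * beta5 + 1.
Proof.
pose A := [:: 19; 7; 5; 3; 2]%BZ; pose B := [:: 17; 13; 5; 3; 2]%BZ.
pose U := [:: 19; 17; 13; 7; 5; 3; 2]%BZ.
have [A_uniq A_pr A_pos] : [/\ uniq (map Z.to_nat A), all prime (map Z.to_nat A) & all (Z.ltb 0) A] by [].
have [B_uniq B_pr B_pos] : [/\ uniq (map Z.to_nat B), all prime (map Z.to_nat B) & all (Z.ltb 0) B] by [].
have [U_uniq U_pr U_pos] : [/\ uniq (map Z.to_nat U), all prime (map Z.to_nat U) & all (Z.ltb 0) U] by [].
pose ev K M := all (sq M) (map Z.to_nat K).
have fiveE : cnt five_event N = cnt (fun M => ev A M || ev B M) N.
  by apply: eq_in_count => M _; rewrite /five_event /= orbF.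
have capE : cnt (fun M => ev A M && ev B M) N = cnt (ev U) N.
  apply: eq_in_count => M _; rewrite /ev /=.
  by do 7?case: (sq M _).
have := cnt_cup (ev A) (ev B) N; rewrite -fiveE capE => /(congr1 (fun n => n%:R : R)).
rewrite !natrD => cupE.
have A_le : (cnt (ev A) N)%:R <= N%:R * wt R (map Z.to_nat A) := cnt_all R N A_uniq.
have B_le : (cnt (ev B) N)%:R <= N%:R * wt R (map Z.to_nat B) := cnt_all R N B_uniq.
have U_le : (cnt (ev U) N)%:R <= N%:R * wt R (map Z.to_nat U) := cnt_all R N U_uniq.
have A_ge : N%:R * wt R (map Z.to_nat A) - 1 <= (cnt (ev A) N)%:R := cnt_all_ge N A_uniq A_pr.
have B_ge : N%:R * wt R (map Z.to_nat B) - 1 <= (cnt (ev B) N)%:R := cnt_all_ge N B_uniq B_pr.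
have U_ge : N%:R * wt R (map Z.to_nat U) - 1 <= (cnt (ev U) N)%:R := cnt_all_ge N U_uniq U_pr.
have betaE : beta5 = wt R (map Z.to_nat A) + wt R (map Z.to_nat B) - wt R (map Z.to_nat U).
  have [_ ->] := wt_Zsqprod A_pos; have [_ ->] := wt_Zsqprod B_pos.
  have [_ ->] := wt_Zsqprod U_pos; rewrite /beta5.
  have -> : Zsqprod U = (881790 ^ 2)%BZ by [].
  have UA : zr (881790 ^ 2) = zr (221 ^ 2) * zr (Zsqprod A) by rewrite -zrM.
  have UB : zr (881790 ^ 2) = zr (133 ^ 2) * zr (Zsqprod B) by rewrite -zrM.
  have -> : zr (221 ^ 2 + 133 ^ 2 - 1) = zr (221 ^ 2) + zr (133 ^ 2) - 1.
    apply/eqP; rewrite -subr_eq opprK -[1]/(1%:R) -zr_nat -!zrD; apply/eqP.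
    by congr zr.
  have UA0 : zr (221 ^ 2) != 0 by rewrite gt_eqF // zr_gt0.
  have UB0 : zr (133 ^ 2) != 0 by rewrite gt_eqF // zr_gt0.
  have U0 : zr (881790 ^ 2) != 0 by rewrite gt_eqF // zr_gt0.
  have -> : (zr (Zsqprod A))^-1 = zr (221 ^ 2) / zr (881790 ^ 2).
    by rewrite UA invfM mulrA divff ?mul1r.
  have -> : (zr (Zsqprod B))^-1 = zr (133 ^ 2) / zr (881790 ^ 2).
    by rewrite UB invfM mulrA divff ?mul1r.
  by rewrite !mulrBl mulrDl mul1r.
by rewrite betaE !mulrBr mulrDr; apply/andP; split; lra.
Qed.

End Density.

(** * Existence of the limit and its bounds *)

Section Limit.
Variable R : realType.
Implicit Types (f g : pred nat) (N M B p q : nat).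
Local Notation zr := (zr R).
Local Notation fixed := (fixed R).

Definition infinite_at M : bool := `[< infinite_type (square_primes M) >].

Lemma square_primesE M p : (0 < M)%N -> (p \in square_primes M) = sq M p.
Proof.
move=> M0; rewrite !inE /= mem_primes M0 /sq /=.
have [p_pr|//] := boolP (prime p); rewrite /=.
apply/andP/idP => [[]//|pM]; split=> //.
by apply: dvdn_trans pM; rewrite -[X in (X %| _)%N]expn1 dvdn_exp2l.
Qed.

Lemma square_primes_prime M : prime_fset (square_primes M).
Proof. by move=> p; rewrite !inE mem_primes => /andP[/and3P[]]. Qed.

Lemma five_event_infinite M : (0 < M)%N -> five_event M -> infinite_at M.
Proof.
move=> M0 /hasP[K K5 /allP KM]; apply/asboolP.
have inP l : all (fun p => p \in map Z.to_nat K) l -> {subset l <= square_primes M}.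
  by move=> /allP lK p /lK pK; rewrite square_primesE // KM.
move: K5 inP; rewrite -[take 2 _]/[:: [:: 19; 7; 5; 3; 2]; [:: 17; 13; 5; 3; 2]]%BZ !inE.
case/predU1P => [->|/eqP ->] inP.
  by apply: infinite_2_3_5_7_19; apply: inP.
by apply: infinite_2_3_5_13_17; apply: inP.
Qed.

(** If [M] contains a listed 6-set whose event fails, the completing prime provides a 5-set. If it
    contains no listed set, the search leaves at least seven primes, all at most [N] and hence in
    the cover. *)
Lemma infinite_events N M : (0 < M <= N)%N -> infinite_at M ->
  [|| five_event M, has (fun K => six_event K M) (drop 2 known_sets) |
      (7 <= count (sq M) (prime_cover N))%N && unknown M].
Proof.
move=> /andP[M0 MN] /asboolP M_inf.
have [unk|] := boolP (unknown M); last first.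
  rewrite negbK => /hasP[_ /mapP[K K_known ->] KM].
  move: (K_known); rewrite -[X in K \in X](cat_take_drop 2) mem_cat => /orP[K5|K6].
    by apply/orP; left; apply/hasP; exists K.
  have [K6M|] := boolP (six_event K M).
    by apply/orP; right; apply/orP; left; apply/hasP; exists K.
  rewrite /six_event KM andTb; case KqE: (completing K) => [//|q s]; rewrite negbK => qM.
  have [_ _ [L L_known LK]] := completingP KqE.
  apply/orP; left; apply/hasP; exists L => //; rewrite all_map; apply/allP => p /LK.
  rewrite inE => /predU1P[->//|pK] /=.
  by apply: (allP KM); rewrite map_f.
apply/orP; right; apply/orP; right; rewrite andbT.
have size7 : (7 <= #|` square_primes M|)%N.
  rewrite leqNgt; apply/negP => small.
  have [K K_known KM] := small_infinite_contains_known (@square_primes_prime M) small M_inf.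
  case/negP: unk; apply/hasP; exists (map Z.to_nat K); first exact: map_f.
  by rewrite all_map; apply/allP => p /KM; rewrite square_primesE.
apply: leq_trans size7 _; rewrite -size_filter; apply: uniq_leq_size.
  exact: fset_uniq.
move=> p; rewrite -[_ \in enum_fset _]/(p \in square_primes M) square_primesE // => pM.
rewrite mem_filter pM; have /andP[p_pr pM'] := pM.
apply: prime_cover_mem => //; apply: leq_trans MN; apply: dvdn_leq M0 _.
by apply: dvdn_trans pM'; rewrite -[X in (X %| _)%N]expn1 dvdn_exp2l.
Qed.

Lemma sum_six N (s : seq (seq Z)) : {subset s <= known_sets} ->
  (\sum_(K <- s) cnt (six_event K) N)%:R <=
  N%:R * fixed (foldr (fun K => Z.add (six_bound K)) 0%BZ s) + (size s)%:R.
Proof.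
elim: s => [_|K s IH sub] /=; first by rewrite big_nil fixed0 mulr0 addr0.
rewrite big_cons natrD fixedD mulrDr -natr1.
have six := cnt_six R N (sub K (mem_head _ _)).
have rest := IH (fun L Ls => sub L (mem_behead (s := K :: s) Ls)).
by move: six rest; lra.
Qed.

Lemma beta5_le : beta5 R <= fixed five_bound.
Proof.
rewrite /five_bound; apply: le_trans (fixed_ceil_div _ _ _) => //.
by rewrite fixed_scaleM.
Qed.

Lemma total_bound_real : fixed total_bound <= 8746 / 10 ^+ 11.
Proof.
have e11 : (10 : R) ^+ 11 = zr (10 ^ 11) by rewrite -[10]/(10%:R) -zr_nat -zrX.
have e0 : 0 < zr (10 ^ 11) by exact: zr_gt0.
rewrite e11 ler_pdivlMr // /fixed mulrAC ler_pdivrMr ?scale_gt0 // -zrM.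
have -> : (8746 : R) = zr 8746 by rewrite -(zr_nat R 8746).
by rewrite -zrM; apply: ler_zr; exact: total_bound_le.
Qed.

Lemma combine_bounds (n i e5 e6 e7 b x y z t : R) :
  i <= e5 + (e6 + e7) -> e5 <= n * b + 1 -> e6 <= n * y + 27 -> e7 <= n * z ->
  n * b <= n * x -> n * (x + y + z) <= n * t -> i <= n * t + 28.
Proof. by lra. Qed.

(** The error 28 is 1 for the two 5-sets together and 1 for each of the 27 6-sets. *)
Lemma cnt_infinite_le N :
  (cnt infinite_at N)%:R <= N%:R * (8746 / 10 ^+ 11) + 28 :> R.
Proof.
have sub : {subset drop 2 known_sets <= known_sets} by move=> K /mem_drop.
have le1 : (cnt infinite_at N <= cnt five_event N + (\sum_(K <- drop 2 known_sets) cnt (six_event K) N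
   + cnt (fun M => (7 <= count (sq M) (prime_cover N))%N && unknown M) N))%N.
  apply: (@leq_trans (cnt (fun M => [|| five_event M,
     has (fun K => six_event K M) (drop 2 known_sets) |
      (7 <= count (sq M) (prime_cover N))%N && unknown M]) N)).
    rewrite /cnt -!size_filter; apply: uniq_leq_size; first by rewrite filter_uniq ?iota_uniq.
    move=> M; rewrite !mem_filter mem_iota => /andP[M_inf M_range].
    by rewrite M_range andbT; apply: infinite_events M_inf; rewrite -ltnS -add1n.
  apply: leq_trans (cnt_or (g := five_event) (h := fun M =>
     has (fun K => six_event K M) (drop 2 known_sets) ||
      ((7 <= count (sq M) (prime_cover N))%N && unknown M)) _ _) _ => //.
  rewrite leq_add2l; apply: leq_trans (cnt_or (g := fun M =>
     has (fun K => six_event K M) (drop 2 known_sets)) (h := fun M =>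
     (7 <= count (sq M) (prime_cover N))%N && unknown M) _ _) _ => //.
  by rewrite leq_add2r; exact: (cnt_has six_event).
rewrite -(ler_nat R) !natrD in le1.
have /andP[_ five] := cnt_five R N.
have six := sum_six N sub; have seven := cnt_seven R N.
have N0 : 0 <= N%:R :> R by [].
have tot := ler_wpM2l N0 total_bound_real.
have five' := ler_wpM2l N0 beta5_le.
set s6 := foldr (fun K => Z.add (six_bound K)) 0%BZ (drop 2 known_sets) in six.
have fixed3 a b c : fixed (a + b + c)%BZ = fixed a + fixed b + fixed c.
  by rewrite !fixedD.
have totE : fixed total_bound = _ := fixed3 five_bound s6 seven_bound.
rewrite totE in tot.
exact: combine_bounds le1 five six seven five' tot.
Qed.

(** Only the integers containing one of the two 5-sets are counted. *)
Lemma cnt_infinite_ge N : N%:R * (847 / 10 ^+ 10) - 2 <= (cnt infinite_at N)%:R :> R.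
Proof.
have /andP[five _] := cnt_five R N.
apply: le_trans (_ : (cnt five_event N)%:R <= _); last first.
  by rewrite ler_nat; apply: sub_cnt => M; exact: five_event_infinite.
apply: le_trans five; rewrite lerD2r ler_wpM2l // /beta5.
have e10 : (10 : R) ^+ 10 = zr (10 ^ 10) by rewrite -[10]/(10%:R) -zr_nat -zrX.
have -> : (847 : R) = zr 847 by rewrite -(zr_nat R 847).
rewrite e10 ler_pdivrMr ?zr_gt0 // mulrAC ler_pdivlMr ?zr_gt0 // -!zrM.
by apply: ler_zr; apply/Z.leb_spec0; vm_compute.
Qed.

Lemma cnt_periodic f Q N : (0 < Q)%N -> (forall M, f (M + Q)%N = f M) ->
  `|(cnt f N)%:R - N%:R * ((cnt f Q)%:R / Q%:R)| <= Q%:R :> R.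
Proof.
move=> Q0 f_per.
have shift k r : count f (iota (1 + k * Q) r) = cnt f r.
  rewrite addnC iotaDl count_map; apply: eq_in_count => M _ /=.
  by elim: k => // k IH; rewrite mulSn -addnA addnC f_per.
have block k r : cnt f (k * Q + r) = (k * cnt f Q + cnt f r)%N.
  elim: k => [|k IH] //; rewrite mulSn -addnA {1}/cnt iotaD count_cat -/(cnt f Q).
  by rewrite -[(1 + Q)%N]/(1 + Q)%N -[Q in (1 + Q)%N]mul1n shift IH mulSn addnA.
have [k [r [-> r_lt]]] : exists k r, N = (k * Q + r)%N /\ (r < Q)%N.
  by exists (N %/ Q)%N, (N %% Q)%N; rewrite -divn_eq ltn_pmod.
have cnt_le n : (cnt f n <= n)%N by rewrite -[X in (_ <= X)%N](size_iota 1); exact: count_size.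
rewrite block; set c := cnt f Q.
have Qr : 0 < Q%:R :> R by rewrite ltr0n.
have -> : (k * c + cnt f r)%:R - (k * Q + r)%:R * (c%:R / Q%:R) =
    (cnt f r)%:R - r%:R * (c%:R / Q%:R) :> R.
  by rewrite !natrD !natrM; field; rewrite gt_eqF.
have c0 : 0 <= c%:R / Q%:R :> R by exact: divr_ge0.
have c1 : c%:R / Q%:R <= 1 :> R by rewrite ler_pdivrMr // mul1r ler_nat cnt_le.
have t0 : 0 <= r%:R * (c%:R / Q%:R) :> R by exact: mulr_ge0.
have t1 : r%:R * (c%:R / Q%:R) <= r%:R :> R by exact: ler_piMr.
have f0 : 0 <= (cnt f r)%:R :> R by exact: ler0n.
have f1 : (cnt f r)%:R <= r%:R :> R by rewrite ler_nat cnt_le.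
have rQ : r%:R <= Q%:R :> R by rewrite ler_nat ltnW.
by rewrite ler_norml; apply/andP; split; move: t0 t1 f0 f1 rQ; move: (_ * _) => t; lra.
Qed.

Definition truncated_infinite B M : bool :=
  `[< infinite_type [fset p in [seq p <- iota 0 B.+1 | sq M p]]%fset >].

Lemma truncated_infinite_periodic B M : truncated_infinite B (M + (B`!) ^ 2)%N = truncated_infinite B M.
Proof.
rewrite /truncated_infinite; congr (`[< infinite_type _ >]); apply/fsetP => p.
rewrite !in_fset !mem_filter; case pB: (p \in iota 0 B.+1); last by rewrite !andbF.
rewrite /sq; case: (boolP (prime p)) => //= p_pr.
by rewrite dvdn_addl // dvdn_exp2r // dvdn_fact // prime_gt0 //=; move: pB; rewrite mem_iota.
Qed.

(** The case of degree 1 of [esym_iota]: the sum of 1/q^2 over q > B is at most 1/B. *)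
Lemma cnt_large_square B N : (0 < B)%N ->
  (cnt (fun M => has (sq M) (iota B.+1 N)) N)%:R <= N%:R / B%:R :> R.
Proof.
move=> B0; have := @cnt_esym R [::] (iota B.+1 N) 1 N (iota_uniq _ _).
rewrite /wt big_nil mul1r => le1.
have le2 := @esym_iota R B.+1 N 1 B0; rewrite /= expr1 in le2.
apply: le_trans (_ : _ <= N%:R * esym R (iota B.+1 N) 1) _; last by rewrite ler_wpM2l.
by apply: le_trans le1; rewrite ler_nat; apply: sub_cnt => M _ /=; rewrite has_count.
Qed.

Lemma infinite_at_truncated B N M : (0 < M <= N)%N -> ~~ has (sq M) (iota B.+1 N) ->
  infinite_at M = truncated_infinite B M.
Proof.
move=> /andP[M0 MN] /hasPn no_large; rewrite /infinite_at /truncated_infinite.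
congr (`[< infinite_type _ >]); apply/fsetP => p; rewrite square_primesE // in_fset mem_filter.
case pM: (sq M p); rewrite ?andFb // andTb; symmetry; rewrite mem_iota /= add0n.
have /andP[p_pr ppM] := pM.
have pN : (p <= N)%N.
  apply: leq_trans MN; apply: dvdn_leq M0 _.
  by apply: dvdn_trans ppM; rewrite -[X in (X %| _)%N]expn1 dvdn_exp2l.
rewrite ltnS leqNgt; apply/negP => Bp.
have /no_large : p \in iota B.+1 N by rewrite mem_iota Bp /=; lia.
by rewrite pM.
Qed.

Definition infinite_ratio : R^nat := fun N => (cnt infinite_at N)%:R / N%:R.

Lemma infinite_ratio_approx B : (0 < B)%N -> exists x : R, exists C : R,
  forall N, (0 < N)%N -> `|infinite_ratio N - x| <= B%:R^-1 + C / N%:R.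
Proof.
move=> B0; pose Q := ((B`!) ^ 2)%N.
have Q0 : (0 < Q)%N by rewrite expn_gt0 fact_gt0.
exists ((cnt (truncated_infinite B) Q)%:R / Q%:R), Q%:R => N N0.
have per := cnt_periodic N Q0 (truncated_infinite_periodic B).
have large := cnt_large_square N B0.
have range M : M \in iota 1 N -> (0 < M <= N)%N by rewrite mem_iota.
have le1 : (cnt infinite_at N <= cnt (truncated_infinite B) N + cnt (fun M => has (sq M) (iota B.+1 N)) N)%N.
  rewrite /cnt -count_predUI; apply: leq_trans (leq_addr _ _).
  rewrite -!size_filter; apply: uniq_leq_size; first by rewrite filter_uniq ?iota_uniq.
  move=> M; rewrite !mem_filter => /andP[M_inf M_in]; rewrite M_in andbT /=.
  have [|no_large] := boolP (has (sq M) _); first by rewrite orbT.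
  by rewrite orbF -(infinite_at_truncated (range M M_in) no_large).
have le2 : (cnt (truncated_infinite B) N <= cnt infinite_at N + cnt (fun M => has (sq M) (iota B.+1 N)) N)%N.
  rewrite /cnt -count_predUI; apply: leq_trans (leq_addr _ _).
  rewrite -!size_filter; apply: uniq_leq_size; first by rewrite filter_uniq ?iota_uniq.
  move=> M; rewrite !mem_filter => /andP[M_inf M_in]; rewrite M_in andbT /=.
  have [|no_large] := boolP (has (sq M) _); first by rewrite orbT.
  by rewrite orbF (infinite_at_truncated (range M M_in) no_large).
move: le1 le2; rewrite -!(ler_nat R) !natrD => le1 le2.
have Nr : 0 < N%:R :> R by rewrite ltr0n.
set x := _ / Q%:R in per *.
have -> : infinite_ratio N - x = ((cnt infinite_at N)%:R - N%:R * x) / N%:R.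
  by rewrite /infinite_ratio; field; rewrite gt_eqF.
rewrite normrM (@gtr0_norm _ N%:R^-1) ?invr_gt0 // ler_pdivrMr // mulrDl divfK ?gt_eqF //.
move: per large; rewrite [_^-1 * _]mulrC !ler_norml => /andP[? ?] ?.
by apply/andP; split; lra.
Qed.

(** The centre [x] may move with [B]: it suffices that the ratios eventually lie within any given
    distance of some constant. *)
Lemma infinite_ratio_cvg : cvgn infinite_ratio.
Proof.
apply/cauchy_cvgP; apply: cauchy_exP => e e0.
have e2 : 0 < 2 / e by rewrite divr_gt0.
pose B := Num.bound (2 / e).
have Be : 2 / e < B%:R by apply: archi_boundP; exact: ltW.
have Br : 0 < B%:R :> R by exact: lt_trans e2 Be.
have B0 : (0 < B)%N by rewrite -(ltr0n R).
have [x [C xC]] := infinite_ratio_approx B0; exists x.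
have C0 : 0 <= 2 * `|C| / e by rewrite divr_ge0 ?mulr_ge0 // ltW.
exists (Num.bound (2 * `|C| / e)).+1 => // N /= CN.
have N0 : (0 < N)%N by apply: leq_trans CN.
have Nr : 0 < N%:R :> R by rewrite ltr0n.
have NC : 2 * `|C| / e < N%:R.
  by apply: lt_trans (archi_boundP C0) _; rewrite ltr_nat.
rewrite /ball /= distrC; apply: le_lt_trans (xC N N0) _.
have BinvE : B%:R^-1 < e / 2.
  by rewrite -[e / 2]invrK ltf_pV2 ?posrE ?invr_gt0 ?divr_gt0 // invf_div.
have CNe : C / N%:R < e / 2.
  rewrite ltr_pdivrMr //; apply: le_lt_trans (ler_norm C) _.
  by move: NC; rewrite ltr_pdivrMr //; lra.
by move: BinvE CNe; lra.
Qed.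

Lemma finite_type_ratioE N : (0 < N)%N -> finite_type_ratio R N = 1 - infinite_ratio N.
Proof.
move=> N0; have finE : #|` finite_type_upto N| = cnt (fun M => ~~ infinite_at M) N.
  rewrite /cnt -size_filter.
  have -> : finite_type_upto N = [fset M in [seq M <- iota 1 N | ~~ infinite_at M]]%fset.
    apply/fsetP => M; rewrite !inE mem_filter andbC /=; congr andb.
    rewrite /infinite_at; apply/asboolP/negP => [fin /asboolP //|noinf].
    by apply: contrapT => M_inf; apply: noinf; apply/asboolP.
  rewrite card_fseq undup_id // filter_uniq ?iota_uniq //.
have totE : (cnt infinite_at N + cnt (fun M => ~~ infinite_at M) N = N)%N.
  by rewrite /cnt -[RHS](size_iota 1); exact: count_predC.
have Nr : N%:R != 0 :> R by rewrite pnatr_eq0 -lt0n.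
rewrite /finite_type_ratio finE /infinite_ratio -{2}totE.
have -> : (cnt (fun M => ~~ infinite_at M) N)%:R = N%:R - (cnt infinite_at N)%:R :> R.
  by apply/eqP; rewrite eq_sym subr_eq addrC -natrD totE.
by rewrite totE mulrBl divff.
Qed.

End Limit.

(** The additive constants 28 and 2 of the counting estimates become errors C / N of the ratios,
    which vanish in the limit. *)
Lemma cvg_le_of_le_add_div (R : realType) (u : R^nat) (l b C : R) :
  u @ \oo --> l -> (forall N, (0 < N)%N -> u N <= b + C / N%:R) -> l <= b.
Proof.
move=> ul u_le; rewrite leNgt; apply/negP => bl.
have e0 : 0 < (l - b) / 2 by rewrite divr_gt0 ?subr_gt0.
move/cvgrPdist_lt: ul => /(_ _ e0)[n _ un].
have C0 : 0 <= 2 * `|C| / (l - b) by rewrite divr_ge0 ?mulr_ge0 // ltW // subr_gt0.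
pose N := maxn n (Num.bound (2 * `|C| / (l - b))).+1.
have N0 : (0 < N)%N by rewrite leq_max orbT.
have Nr : 0 < N%:R :> R by rewrite ltr0n.
have NC : 2 * `|C| / (l - b) < N%:R.
  by apply: lt_trans (archi_boundP C0) _; rewrite ltr_nat leq_max leqnn orbT.
have CNe : C / N%:R < (l - b) / 2.
  rewrite ltr_pdivrMr //; apply: le_lt_trans (ler_norm C) _.
  by move: NC; rewrite ltr_pdivrMr ?subr_gt0 //; lra.
have := un N (leq_maxl _ _); rewrite /= ltr_norml => /andP[_].
by have := u_le N N0; lra.
Qed.

Lemma known_sets_size (K : seq Z) : K \in known_sets -> (5 <= size K)%N.
Proof. by move: K; apply/allP. Qed.

(* Ring numerals are unary, so the bounds 0.99999991254 and 0.9999999153 are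
   written 1 - 8746 / 10^11 and 1 - 847 / 10^10. *)
Theorem theorem1p5 (R : realType) :
  [/\ forall P : {fset nat}, prime_fset P -> (#|` P| <= 4)%N -> finite_type P,
      forall r : nat, (5 <= r)%N ->
        finite_set [set P : {fset nat} | primitive_set P /\ #|` P| = r] &
      cvgn (finite_type_ratio R) /\
      1 - 8746 / 10 ^+ 11 <= limn (finite_type_ratio R) <= 1 - 847 / 10 ^+ 10].
Proof.
split=> [P P_prime P_size|r _|]; last 1 first.
- have inf_cvg := @infinite_ratio_cvg R.
  have ratio_cvg : finite_type_ratio R @ \oo --> 1 - limn (infinite_ratio R).
    have : (fun N => 1 - infinite_ratio R N) @ \oo --> 1 - limn (infinite_ratio R).
      by apply: cvgB; [exact: cvg_cst|exact: inf_cvg].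
    apply: cvg_trans; apply: near_eq_cvg; exists 1%N => // N N1.
    by rewrite finite_type_ratioE.
  split; first by apply/cvg_ex; exists (1 - limn (infinite_ratio R)).
  rewrite (cvg_lim _ ratio_cvg) // lerD2l lerN2 lerD2l lerN2.
  apply/andP; split.
    apply: (@cvg_le_of_le_add_div R _ _ _ 28 inf_cvg) => N N0.
    have Nr : 0 < N%:R :> R by rewrite ltr0n.
    by rewrite /infinite_ratio ler_pdivrMr // mulrDl divfK ?gt_eqF // mulrC cnt_infinite_le.
  rewrite -lerN2; apply: (@cvg_le_of_le_add_div R (fun N => - infinite_ratio R N) _ _ 2).
    exact: cvgN.
  move=> N N0; have Nr : 0 < N%:R :> R by rewrite ltr0n.
  rewrite /infinite_ratio -mulNr ler_pdivrMr // mulrDl divfK ?gt_eqF //.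
  have := cnt_infinite_ge R N; move: (847 / _) => b; lra.
(* Otherwise the set would contain a listed one, and these have at least five elements. *)
- apply: contrapT => P_inf.
  have P6 : (#|` P| <= 6)%N by apply: leq_trans P_size _.
  have [K K_known KP] := small_infinite_contains_known P_prime P6 P_inf.
  have [K_uniq _ _] := known_sets_prime K_known.
  have : (size (map Z.to_nat K) <= #|` P|)%N.
    by apply: uniq_leq_size => // _ /mapP[p pK ->]; exact: KP.
  rewrite size_map => K_le; have := known_sets_size K_known.
  by move=> K5; move: (leq_trans K5 (leq_trans K_le P_size)).
exact: finite_primitive_sets.
Qed.
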